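(* Let $P$ be a partially ordered set on the ground set $[n]=\{1,\dots,n\}$ and let $\mathcal{E}_P\subset\mathbb{R}^n$ be its enriched chain polytope. Then $\mathcal{E}_P$ is a reflexive polytope having a flag regular unimodular triangulation such that each maximal simplex contains the origin as a vertex.
   Context: An antichain of a finite poset $P$ on $[n]$ is a subset of pairwise incomparable elements (the empty set is an antichain). Let $\mathbf{e}_i$ be the $i$-th unit coordinate vector of $\mathbb{R}^n$. The enriched chain polytope $\mathcal{E}_P$ is the convex hull of $$E(P)=\{\pm\mathbf{e}_{i_1}\pm\dots\pm\mathbf{e}_{i_k} : \{i_1,\dots,i_k\}\text{ is an antichain of }P\},$$ where all choices of signs are allowed and the empty antichain corresponds to the origin $\mathbf{0}$. It is a lattice polytope of dimension $n$ (all vertices have integer coordinates). A lattice polytope $\mathcal{P}\subset\mathbb{R}^n$ of dimension $n$ is reflexive if $\mathbf{0}$ is the unique lattice point in the interior of $\mathcal{P}$ and the dual polytope $\mathcal{P}^\vee=\{\mathbf{y}\in\mathbb{R}^n:\langle\mathbf{x},\mathbf{y}\rangle\le 1\text{ for all }\mathbf{x}\in\mathcal{P}\}$ is also a lattice polytope, where $\langle\cdot,\cdot\rangle$ is the usual inner product. A triangulation of a lattice polytope (with lattice points as vertices) is unimodular if every maximal simplex has normalized volume $1$ (i.e. Euclidean volume $1/n!$); it is regular if it is induced by the lower faces of a lifting of its points by some height function; it is flag if every minimal non-face of the underlying simplicial complex has exactly two elements. *)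

(* Defs.v *)
From HB Require Import structures.
From mathcomp Require Import all_boot all_order all_algebra finmap.
From mathcomp Require Import all_classical all_reals all_analysis.

Set Implicit Arguments.
Unset Strict Implicit.
Unset Printing Implicit Defensive.

Import Order.TTheory GRing.Theory Num.Theory.
Import numFieldNormedType.Exports.

Local Open Scope classical_set_scope.
Local Open Scope ring_scope.

Section Polytopes.
Variable R : realType.

Definition convex_hull n (A : set 'rV[R]_n) : set 'rV[R]_n :=
  smallest (@convex_set R 'rV[R]_n) A.

Definition dotp n (x y : 'rV[R]_n) : R := \sum_i x 0 i * y 0 i.

Definition lattice_point {n} : set 'rV[R]_n := [set x | x \is a mxOver Num.int].

Definition lattice_polytope n (P : set 'rV[R]_n) : Prop :=
  exists S : set 'rV[R]_n,
    [/\ finite_set S, S `<=` lattice_point & P = convex_hull S].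

Definition affinely_independent n (s : {fset 'rV[R]_n}) : Prop :=
  forall a : 'rV[R]_n -> R,
    \sum_(v <- s) a v = 0 -> \sum_(v <- s) a v *: v = 0 ->
    forall v, v \in s -> a v = 0.

(* The affine hull of P is the whole space, i.e. dim P = n. *)
Definition full_dimensional n (P : set 'rV[R]_n) : Prop :=
  exists s : {fset 'rV[R]_n},
    [/\ affinely_independent s, #|` s| = n.+1 & [set` s] `<=` P].

Definition dual_polytope n (P : set 'rV[R]_n) : set 'rV[R]_n :=
  [set y | forall x, P x -> dotp x y <= 1].

Definition reflexive_polytope n (P : set 'rV[R]_n) : Prop :=
  [/\ lattice_polytope P,
      full_dimensional P,
      interior P `&` lattice_point = [set 0]
    & lattice_polytope (dual_polytope P)].

(* Lebesgue measure on R^n, as an iterated integral over the coordinates;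
   by Tonelli this is the n-dimensional Lebesgue measure on Borel sets, in
   particular on simplices. *)
Fixpoint volume n : set 'rV[R]_n -> \bar R :=
  match n with
  | 0 => fun A => (\1_A (0 : 'rV[R]_0))%:E
  | m.+1 => fun A =>
      (\int[@lebesgue_measure R]_t
         volume [set y : 'rV[R]_m | A (row_mx (t%:M : 'M[R]_1) y)])%E
  end.

Definition normalized_volume n (A : set 'rV[R]_n) : \bar R :=
  ((n`!%:R)%:E * volume A)%E.

(* A triangulation is given by the vertex sets of its simplices, the empty
   simplex included. *)
Definition triangulation n (P : set 'rV[R]_n)
    (K : {fset {fset 'rV[R]_n}}) : Prop :=
  [/\ forall s, s \in K ->
        affinely_independent s /\ [set` s] `<=` lattice_point,
      forall s t : {fset 'rV[R]_n}, s \in K -> (t `<=` s)%fset -> t \in K,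
      forall s t : {fset 'rV[R]_n}, s \in K -> t \in K ->
        convex_hull [set` s] `&` convex_hull [set` t] = convex_hull [set` (s `&` t)%fset]
    & \bigcup_(s in [set` K]) convex_hull [set` s] = P].

Definition maximal_simplex n (K : {fset {fset 'rV[R]_n}})
    (s : {fset 'rV[R]_n}) : Prop :=
  s \in K /\ forall t, t \in K -> (s `<=` t)%fset -> t = s.

Definition unimodular n (K : {fset {fset 'rV[R]_n}}) : Prop :=
  forall s, maximal_simplex K s -> normalized_volume (convex_hull [set` s]) = 1%E.

Definition minimal_nonface n (K : {fset {fset 'rV[R]_n}})
    (s : {fset 'rV[R]_n}) : Prop :=
  [/\ forall v, v \in s -> [fset v]%fset \in K,
      s \notin K
    & forall t : {fset 'rV[R]_n}, (t `<` s)%fset -> t \in K].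

Definition flag_complex n (K : {fset {fset 'rV[R]_n}}) : Prop :=
  forall s, minimal_nonface K s -> #|` s| = 2%N.

(* The lattice points a of P lifted to (a, w a). *)
Definition lifted_polytope n (P : set 'rV[R]_n) (w : 'rV[R]_n -> R) :
    set 'rV[R]_(n + 1) :=
  convex_hull [set row_mx a (w a)%:M | a in P `&` lattice_point].

(* Lower faces are those minimizing a linear functional whose last coefficient
   is positive. *)
Definition lower_face n (Q F : set 'rV[R]_(n + 1)) : Prop :=
  exists c : 'rV[R]_(n + 1), 0 < c 0 (rshift n ord0) /\
    F = [set y | Q y /\ forall z, Q z -> dotp c y <= dotp c z].

Definition regular n (P : set 'rV[R]_n) (K : {fset {fset 'rV[R]_n}}) : Prop :=
  exists w : 'rV[R]_n -> R,
    [set convex_hull [set` s] | s in [set s | s \in K /\ s != fset0]] =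
    [set lsubmx @` F | F in lower_face (lifted_polytope P w)].

End Polytopes.

Definition antichain n (le : rel 'I_n) (A : {set 'I_n}) : Prop :=
  forall i j, i \in A -> j \in A -> i != j -> ~~ le i j /\ ~~ le j i.

Definition enriched_points (R : realType) n (le : rel 'I_n) : set 'rV[R]_n :=
  [set x | exists (A : {set 'I_n}) (e : 'I_n -> bool),
     antichain le A /\ x = \sum_(i in A) (-1) ^+ e i *: delta_mx 0 i].

Arguments enriched_points R {n} le.

Definition enriched_chain_polytope (R : realType) n (le : rel 'I_n) :
    set 'rV[R]_n :=
  convex_hull (enriched_points R le).

Arguments enriched_chain_polytope R {n} le.

(* Main.v *)
(* On the orthant with signs e, the polytope is a signed copy of the chain
   polytope, whose lattice points are the antichains; an antichain is encoded by
   the filter it generates, and two signed antichains are called compatible when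
   they lie in a common orthant and their filters are nested.  The simplices are
   the sets of pairwise compatible points, so the complex is flag.

   Give a signed antichain the height "number of order ideals meeting its
   support".  A simplex is cut out by an affine function lying below the heights
   and touching them exactly at its vertices: sum over the order ideals Z the
   signed indicator of a chain inside Z that hits every vertex meeting Z.
   Conversely two incompatible points u, v can be exchanged for points a, b with
   a + b = u + v and smaller total height, so no such function touches both.
   This gives regularity, affine independence and the intersection property.
   Greedily peeling off minimal elements writes any point all of whose chain sums
   are at most 1 as a convex combination of the vertices of a simplex; hence the
   simplices cover the polytope, which is therefore cut out by the signed chains;
   by separation the dual is the convex hull of the signed chains.

   The nonzero vertices of a maximal simplex form, after sorting, a triangular
   matrix with diagonal entries 1 and -1, and the volume is computed by slicing
   along one coordinate after another, using Tonelli to choose the order. *)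
Require Import Defs.
From HB Require Import structures.
From mathcomp Require Import all_boot all_order all_algebra finmap.
From mathcomp Require Import all_classical all_reals all_analysis.
From mathcomp Require Import measurable_realfun.
From mathcomp Require Import ring lra.

Set Implicit Arguments.
Unset Strict Implicit.
Unset Printing Implicit Defensive.

Import Order.TTheory GRing.Theory Num.Theory.
Import numFieldNormedType.Exports.

Local Open Scope classical_set_scope.
Local Open Scope ring_scope.

(** * Convex hulls and separation *)

Section ConvexHull.
Variable R : realType.

Lemma convex_setP n (A : set 'rV[R]_n) :
  @convex_set R 'rV[R]_n A <->
  forall x y t, A x -> A y -> 0 <= t <= 1 -> A (t *: x + (1 - t) *: y).
Proof.
split=> [cA x y t Ax Ay /andP[t0 t1]|cA x y t].
  have tP : Itv.spec (@Itv.num_sem R) (Itv.Real `[0%Z, 1%Z]) t.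
    by rewrite /= /Itv.num_sem/= num_real/= in_itv /= t0 t1.
  have := cA x y (Itv.mk tP).
  by rewrite !inE; apply.
rewrite !inE => Ax Ay; apply: cA => //.
by rewrite ge0 le1.
Qed.

(** Membership in [A] is asked only at positive weights, so the lemma also serves to restrict a
    combination to its support. Induction runs on the sum divided by its total weight. *)
Lemma convex_set_sum n (A : set 'rV[R]_n) (T : eqType) (r : seq T)
    (l : T -> R) (f : T -> 'rV[R]_n) :
  @convex_set R 'rV[R]_n A -> (forall i, i \in r -> 0 <= l i) ->
  \sum_(i <- r) l i = 1 -> (forall i, i \in r -> 0 < l i -> A (f i)) ->
  A (\sum_(i <- r) l i *: f i).
Proof.
move=> /convex_setP cA l0 l1 Af.
suff : 0 < \sum_(i <- r) l i ->
    A ((\sum_(i <- r) l i)^-1 *: \sum_(i <- r) l i *: f i).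
  by rewrite l1 invr1 scale1r; apply; apply: ltr01.
clear l1; elim: r l0 Af => [|i r IH] l0 Af; first by rewrite big_nil ltxx.
rewrite !big_cons; set L := \sum_(j <- r) l j => Lpos.
have li0 : 0 <= l i by apply: l0; rewrite mem_head.
have L0 : 0 <= L.
  by rewrite /L big_seq sumr_ge0// => j jr; apply: l0; rewrite in_cons jr orbT.
have {}IH : 0 < L -> A (L^-1 *: \sum_(j <- r) l j *: f j).
  by apply: IH => j jr; [apply: l0|apply: Af]; rewrite in_cons jr orbT.
have [Lz|Lnz] := eqVneq L 0.
  have lip : 0 < l i by rewrite Lz addr0 in Lpos.
  rewrite [X in _ *: (_ + X)](_ : _ = 0); last first.
    rewrite big_seq big1// => j jr.
    suff -> : l j = 0 by rewrite scale0r.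
    move/eqP : Lz; rewrite /L big_seq psumr_eq0; last first.
      by move=> k kr; apply: l0; rewrite in_cons kr orbT.
    by move/allP => /(_ _ jr); rewrite jr => /eqP.
  rewrite Lz !addr0 scalerA mulVf ?gt_eqF// scale1r.
  by apply: Af => //; rewrite mem_head.
have Lp : 0 < L by rewrite lt_def Lnz.
have [liz|linz] := eqVneq (l i) 0.
  by rewrite liz scale0r !add0r; exact: IH.
have lip : 0 < l i by rewrite lt_def linz.
have LiL : 0 < l i + L by rewrite addr_gt0.
have t01 : 0 <= l i / (l i + L) <= 1.
  by rewrite divr_ge0 ?(ltW LiL)//= ler_pdivrMr// mul1r lerDl.
have := cA (f i) (L^-1 *: \sum_(j <- r) l j *: f j) (l i / (l i + L))
  (Af _ (mem_head _ _) lip) (IH Lp) t01.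
have -> : 1 - l i / (l i + L) = L / (l i + L) by field; rewrite gt_eqF.
rewrite scalerDr !scalerA.
have -> : L / (l i + L) * L^-1 = (l i + L)^-1 by field; rewrite !gt_eqF.
by rewrite [l i / _]mulrC.
Qed.

Lemma convex_convex_hull n (A : set 'rV[R]_n) :
  @convex_set R 'rV[R]_n (convex_hull A).
Proof.
apply/convex_setP => x y t hx hy t01 B [cB AB].
by move/convex_setP: (cB); apply => //; [apply: hx|apply: hy].
Qed.

Lemma convex_hull_sub n (A B : set 'rV[R]_n) :
  @convex_set R 'rV[R]_n B -> A `<=` B -> convex_hull A `<=` B.
Proof. by move=> cB AB; apply: smallest_sub. Qed.

Lemma subset_convex_hull n (A : set 'rV[R]_n) : A `<=` convex_hull A.
Proof. exact: sub_smallest. Qed.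

Lemma le_convex_hull n (A B : set 'rV[R]_n) :
  A `<=` B -> convex_hull A `<=` convex_hull B.
Proof.
move=> AB; apply: convex_hull_sub; first exact: convex_convex_hull.
exact: (subset_trans AB (@subset_convex_hull _ _)).
Qed.

(** Combinations with weights on [s] form a convex set containing the generators, so the smallest
    convex set lies among them. *)
Lemma convex_hull_imageP n (T : choiceType) (s : {fset T}) (f : T -> 'rV[R]_n)
    (x : 'rV[R]_n) :
  convex_hull [set f a | a in [set` s]] x <->
  exists l : T -> R, [/\ forall a, a \in s -> 0 <= l a,
    \sum_(a <- s) l a = 1 & x = \sum_(a <- s) l a *: f a].
Proof.
split=> [|[l [l0 l1 ->]]]; last first.
  apply: convex_set_sum => //; first exact: convex_convex_hull.
  by move=> a sa _; apply: subset_convex_hull; exists a.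
move: x; apply: convex_hull_sub; last first.
  move=> _ [a sa <-]; exists (fun b => (b == a)%:R); split.
  - by move=> b _; rewrite ler0n.
  - rewrite (big_fsetD1 a)//= eqxx big1_seq ?addr0// => b.
    by rewrite in_fsetD1 => /andP[_ /andP[/negPf-> _]].
  - rewrite (big_fsetD1 a)//= eqxx scale1r big1_seq ?addr0// => b.
    by rewrite in_fsetD1 => /andP[_ /andP[/negPf-> _]]; rewrite scale0r.
apply/convex_setP => _ _ t [l [l0 l1 ->]] [m [m0 m1 ->]] /andP[t0 t1].
exists (fun a => t * l a + (1 - t) * m a); split.
- by move=> a sa; rewrite addr_ge0 ?mulr_ge0 ?subr_ge0 ?l0 ?m0.
- by rewrite big_split/= -!mulr_sumr l1 m1; ring.
- rewrite !scaler_sumr -big_split/=; apply: eq_bigr => a _.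
  by rewrite !scalerA scalerDl.
Qed.

Lemma convex_hull_fsetP n (s : {fset 'rV[R]_n}) (x : 'rV[R]_n) :
  convex_hull [set` s] x <->
  exists l : 'rV[R]_n -> R, [/\ forall a, a \in s -> 0 <= l a,
    \sum_(a <- s) l a = 1 & x = \sum_(a <- s) l a *: a].
Proof. by rewrite -[[set` s]]image_id; exact: convex_hull_imageP. Qed.

(** * Inner product, separation and polarity *)

Lemma dotpDr n (c x y : 'rV[R]_n) : dotp c (x + y) = dotp c x + dotp c y.
Proof. by rewrite /dotp -big_split; apply: eq_bigr => i _; rewrite mxE mulrDr. Qed.

Lemma dotpZr n (c x : 'rV[R]_n) k : dotp c (k *: x) = k * dotp c x.
Proof. by rewrite /dotp mulr_sumr; apply: eq_bigr => i _; rewrite mxE mulrCA. Qed.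

Lemma dotpC n (c x : 'rV[R]_n) : dotp c x = dotp x c.
Proof. by apply: eq_bigr => i _; rewrite mulrC. Qed.

Lemma dotp0r n (c : 'rV[R]_n) : dotp c 0 = 0.
Proof. by rewrite /dotp big1// => i _; rewrite mxE mulr0. Qed.

Lemma dotp_sumr n (c : 'rV[R]_n) I (r : seq I) (P : pred I) (f : I -> 'rV[R]_n) :
  dotp c (\sum_(i <- r | P i) f i) = \sum_(i <- r | P i) dotp c (f i).
Proof. by elim/big_ind2: _ => [|x ? y ? <- <-|]; rewrite ?dotp0r ?dotpDr. Qed.

Lemma dotpDD n (x y : 'rV[R]_n) :
  dotp (x + y) (x + y) = dotp x x + dotp x y *+ 2 + dotp y y.
Proof.
by rewrite dotpDr [dotp _ x]dotpC [dotp _ y]dotpC !dotpDr [dotp y x]dotpC; ring.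
Qed.

Lemma dotp_row_mx m n (a b : 'rV[R]_m) (c d : 'rV[R]_n) :
  dotp (row_mx a c) (row_mx b d) = dotp a b + dotp c d.
Proof.
by rewrite /dotp big_split_ord; congr (_ + _);
  apply: eq_bigr => i _; rewrite ?row_mxEl ?row_mxEr.
Qed.

Lemma dotp_ge0 n (x : 'rV[R]_n) : 0 <= dotp x x.
Proof. by apply: sumr_ge0 => i _; rewrite -expr2 sqr_ge0. Qed.

Lemma dotp_eq0 n (x : 'rV[R]_n) : dotp x x = 0 -> x = 0.
Proof.
move/eqP; rewrite psumr_eq0; last by move=> i _; rewrite -expr2 sqr_ge0.
move/allP => h; apply/rowP => i; rewrite mxE; apply/eqP.
by have := h i (mem_index_enum _); rewrite -expr2 sqrf_eq0.
Qed.

Lemma convex_halfspace n (c : 'rV[R]_n) (d : R) :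
  @convex_set R 'rV[R]_n [set x | dotp c x <= d].
Proof.
apply/convex_setP => x y t /= hx hy /andP[t0 t1].
rewrite dotpDr !dotpZr.
have := ler_wpM2l t0 hx; have : 0 <= 1 - t by lra.
by move=> s0; have := ler_wpM2l s0 hy; lra.
Qed.

Lemma continuous_sum (T : topologicalType) I (r : seq I) (f : I -> T -> R) :
  (forall i, continuous (f i)) -> continuous (fun x => \sum_(i <- r) f i x).
Proof.
by move=> cf; apply: (@continuous_big R I +%R 0 xpredT (@add_continuous R)).
Qed.

(* The separating direction points from the closest point of the hull to [y]. *)
Lemma convex_hull_separation n N (f : 'I_N -> 'rV[R]_n) (y : 'rV[R]_n) :
  (0 < N)%N -> ~ convex_hull (range f) y ->
  exists z d, (forall i, dotp z (f i) <= d) /\ d < dotp z y.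
Proof.
move=> N0 yf.
(* The hull is the image under [p] of the compact standard simplex [D], so the squared distance [g]
   to [y] attains its minimum there. *)
pose D : set 'rV[R]_N := [set l | (forall i, `[0, 1]%classic (l 0 i)) /\
  \sum_i l 0 i = 1].
pose p (l : 'rV[R]_N) := \sum_i l 0 i *: f i.
pose g l := dotp (y - p l) (y - p l).
have D0 : D !=set0.
  exists (delta_mx 0 (Ordinal N0)); split => [i|].
    by rewrite !mxE /= in_itv /=; case: (i == _); rewrite /= ?lexx ?ler01.
  rewrite (bigD1 (Ordinal N0))//= big1 ?addr0; last first.
    by move=> i /negPf inz; rewrite mxE inz andbF.
  by rewrite mxE !eqxx.
have clD : closed D.
  apply: closedI.
    rewrite [X in closed X](_ : _ = \bigcap_i [set l : 'rV[R]_N | `[0, 1]%classic (l 0 i)]).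
      apply: closed_bigI => i _.
      apply: (@closed_comp _ _ (fun l : 'rV[R]_N => l 0 i)) => //.
        by move=> l _; exact: coord_continuous.
      exact: interval_closed.
    by apply/seteqP; split => l h i; [move=> _; exact: h|exact: h i I].
  apply: (@closed_comp _ _ (fun l : 'rV[R]_N => \sum_i l 0 i) [set 1]).
    by move=> l _; apply: continuous_sum => i; exact: coord_continuous.
  exact: closed_eq.
have cube : compact [set l : 'rV[R]_N | forall i, l ord0 i \in `[0, 1]].
  apply: (@rV_compact _ _ (fun=> `[(0 : R), 1]%classic)) => _.
  exact: segment_compact.
have cD : compact D by apply: subclosed_compact clD cube _ => l [].
have cg : continuous g.
  apply: continuous_sum => i x.
  have cy : {for x, continuous (fun l => (y - p l) 0 i)}.
    rewrite (_ : (fun _ => _) = fun l : 'rV[R]_N => y 0 i - \sum_j l 0 j * f j 0 i).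
      apply: continuousB; first exact: cst_continuous.
      apply: continuous_sum => j l.
      by apply: continuousM; [exact: coord_continuous|exact: cst_continuous].
    apply/funext => l; rewrite !mxE summxE; congr (_ - _).
    by apply: eq_bigr => j _; rewrite mxE.
  exact: continuousM.
have [l lD lmin] := EVT_min_rV D0 cD (continuous_subspaceT cg).
move: lD; rewrite inE => -[l01 l1].
set z := y - p l.
exists z, (dotp z (p l)); split; last first.
  rewrite -subr_gt0 -[X in _ - X]mul1r -mulNr -dotpZr -dotpDr scaleN1r.
  rewrite lt_def dotp_ge0 andbT; apply/eqP => /dotp_eq0/eqP.
  rewrite subr_eq0 => /eqP yE; apply: yf; rewrite yE.
  apply: convex_set_sum => //; first exact: convex_convex_hull.
    by move=> i _; have /= := l01 i; rewrite in_itv => /andP[].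
  by move=> i _ _; apply: subset_convex_hull; exists i.
move=> i; rewrite leNgt; apply/negP => zlt.
pose a := dotp z (f i - p l); pose b := dotp (f i - p l) (f i - p l).
have a0 : 0 < a.
  by rewrite /a -scaleN1r dotpDr dotpZr mulN1r subr_gt0.
have b0 : 0 <= b by exact: dotp_ge0.
(* Moving from [p l] towards [f i] by the fraction [t] lowers the squared distance by
   [t * (2a - t * b)]; this [t] is in (0, 1] and has [t * b <= a], so the minimum would be
   beaten. *)
pose t := a / (a + b).
have ab0 : 0 < a + b by rewrite ltr_wpDr.
have t0 : 0 < t by rewrite divr_gt0.
have t1 : t <= 1 by rewrite ler_pdivrMr// mul1r lerDl.
have tE : t = a / (a + b) by [].
clearbody t.
pose m := (1 - t) *: l + t *: delta_mx 0 i.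
have mE j : m 0 j = (1 - t) * l 0 j + t * (j == i)%:R by rewrite !mxE.
have mD : m \in D.
  rewrite inE; split => [j|].
    have /= := l01 j; rewrite mE !in_itv/= => /andP[? ?].
    have ? : 0 <= (j == i)%:R :> R by rewrite ler0n.
    have ? : (j == i)%:R <= 1 :> R by rewrite lern1 leq_b1.
    by apply/andP; split; nra.
  under eq_bigr do rewrite mE.
  rewrite big_split/= -!mulr_sumr l1 (bigD1 i)//= eqxx big1 ?addr0.
    by rewrite !mulr1 subrK.
  by move=> j /negPf ->.
have pD : \sum_j (j == i)%:R *: f j = f i.
  rewrite (bigD1 i)//= eqxx scale1r big1 ?addr0// => j /negPf ->.
  by rewrite scale0r.
have pm : p m = p l + t *: (f i - p l).
  rewrite /p; under eq_bigr do rewrite mE scalerDl -!scalerA.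
  rewrite big_split/= -!scaler_sumr pD.
  rewrite scalerBl scale1r scalerBr.
  by rewrite -!addrA [- _ + _]addrC.
have := lmin _ mD; rewrite /g pm opprD addrA -/z.
have -> : dotp (z - t *: (f i - p l)) (z - t *: (f i - p l)) =
    dotp z z - t * a *+ 2 + t ^+ 2 * b.
  rewrite -scaleNr dotpDD !dotpZr [dotp (_ *: _) _]dotpC dotpZr -/a -/b.
  by ring.
have -> : dotp z z - t * a *+ 2 + t ^+ 2 * b = dotp z z - t * (a *+ 2 - t * b) by ring.
have : 0 < a *+ 2 - t * b.
  rewrite subr_gt0 (@le_lt_trans _ _ a)//; last by rewrite mulr2n ltrDl.
  by rewrite tE mulrAC ler_pdivrMr// mulrDr lerDr mulr_ge0// ltW.
move=> /(mulr_gt0 t0); lra.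
Qed.

(** Since [0] lies in [S], a functional separating [y] from the hull has a bound [d >= 0]. Divided
    by a level strictly between [d] and its value at [y], it lies in the dual of [S] but exceeds 1
    at [y]. *)
Lemma bipolar n (S : set 'rV[R]_n) (y : 'rV[R]_n) :
  finite_set S -> S 0 -> dual_polytope (dual_polytope S) y -> convex_hull S y.
Proof.
move=> Sfin S0 Sy; apply: contrapT => yS.
pose s := fset_set S.
have sS x : (x \in s) = (x \in S) by rewrite /s in_fset_set.
pose f (i : 'I_#|` s|) := s`_i.
have N0 : (0 < #|` s|)%N.
  by rewrite cardfs_gt0; apply/fset0Pn; exists 0; rewrite sS inE.
have fS : range f = S.
  apply/seteqP; split => [_ [i _ <-]|x Sx].
    have : f i \in s by rewrite mem_nth.
    by rewrite sS inE.
  have xs : x \in s by rewrite sS inE.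
  have xi : (index x s < #|` s|)%N by rewrite index_mem.
  by exists (Ordinal xi) => //; rewrite /f/= nth_index.
have [|z [d [zd dy]]] := @convex_hull_separation _ _ f y N0; first by rewrite fS.
have {}zd x : S x -> dotp z x <= d by rewrite -fS => -[i _ <-].
have d0 : 0 <= d by rewrite -(dotp0r z); exact: zd.
pose b := (d + dotp z y) / 2.
have b0 : 0 < b by rewrite /b; lra.
have bz : dual_polytope S (b^-1 *: z).
  move=> x Sx; rewrite dotpZr ler_pdivrMl// mulr1 dotpC.
  by apply: le_trans (zd _ Sx) _; rewrite /b; lra.
have := Sy _ bz; rewrite dotpC dotpZr dotpC ler_pdivrMl// mulr1 /b; lra.
Qed.

End ConvexHull.

(** * Regular subdivisions *)

Section Exposed.
Variables (R : realType) (n : nat) (E : {fset 'rV[R]_n}) (w : 'rV[R]_n -> R).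
Implicit Types (s t : {fset 'rV[R]_n}) (a v : 'rV[R]_n).

(* [s] spans a cell of the regular subdivision of [E] with heights [w]. *)
Definition exposed s : Prop := exists c d, forall a, a \in E ->
  dotp c a + d <= w a /\ (dotp c a + d = w a <-> a \in s).

Lemma affine_sum (c : 'rV[R]_n) (d : R) s (l : 'rV[R]_n -> R) :
  \sum_(v <- s) l v * (dotp c v + d) =
  dotp c (\sum_(v <- s) l v *: v) + d * \sum_(v <- s) l v.
Proof.
rewrite dotp_sumr mulr_sumr -big_split/=; apply: eq_bigr => v _.
by rewrite dotpZr mulrDr [d * _]mulrC.
Qed.

(** Points outside [s] can be separated one at a time: the average of two affine functions below the
    heights touches them only where both do. *)
Lemma exposed_pointwise s :
  (exists c d, (forall a, a \in E -> dotp c a + d <= w a) /\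
    (forall v, v \in s -> dotp c v + d = w v)) ->
  (forall a, a \in E -> a \notin s -> exists c d,
    [/\ forall b, b \in E -> dotp c b + d <= w b,
      forall v, v \in s -> dotp c v + d = w v & dotp c a + d < w a]) ->
  exposed s.
Proof.
move=> base pt.
suff : forall r : seq 'rV[R]_n, {subset r <= E} -> exists c d,
    [/\ forall b, b \in E -> dotp c b + d <= w b,
      forall v, v \in s -> dotp c v + d = w v &
      forall a, a \in r -> a \notin s -> dotp c a + d < w a].
  move=> /(_ E (fun _ => id))[c [d [le_w eq_w lt_w]]]; exists c, d => a aE.
  split; first exact: le_w.
  split => [cda|]; last exact: eq_w.
  by apply/negPn/negP => /(lt_w _ aE); rewrite cda ltxx.
elim=> [_|a r IH arE].
  by have [c [d [le_w eq_w]]] := base; exists c, d; split.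
have [c [d [le_w eq_w lt_w]]] : exists c d,
    [/\ forall b, b \in E -> dotp c b + d <= w b,
      forall v, v \in s -> dotp c v + d = w v &
      forall b, b \in r -> b \notin s -> dotp c b + d < w b].
  by apply: IH => b br; apply: arE; rewrite in_cons br orbT.
have [as_|ans] := boolP (a \in s).
  exists c, d; split => // b; rewrite in_cons => /predU1P[->|]; last exact: lt_w.
  by rewrite as_.
have [c' [d' [le_w' eq_w' lt_w']]] := pt a (arE a (mem_head _ _)) ans.
have midE b : dotp (2^-1 *: (c + c')) b + 2^-1 * (d + d') =
    2^-1 * ((dotp c b + d) + (dotp c' b + d')).
  by rewrite dotpC dotpZr dotpDr ![dotp b _]dotpC; ring.
exists (2^-1 *: (c + c')), (2^-1 * (d + d')); split.
- by move=> b bE; rewrite midE; have := le_w b bE; have := le_w' b bE; lra.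
- by move=> v vs; rewrite midE eq_w// eq_w'//; lra.
- move=> b; rewrite in_cons midE => /predU1P[->|br] bs.
    by have := le_w a (arE a (mem_head _ _)); lra.
  have bE : b \in E by apply: arE; rewrite in_cons br orbT.
  by have := lt_w b br bs; have := le_w' b bE; lra.
Qed.

(** The affine functions exposing [s] and [s] without [v] agree on [s] except at [v]; pairing their
    difference with an affine dependence isolates the coefficient of [v]. *)
Lemma exposed_affinely_independent s : (s `<=` E)%fset ->
  (forall t, (t `<=` s)%fset -> exposed t) -> affinely_independent s.
Proof.
move=> /fsubsetP sE exps l l0 l1 v vs.
have [c [d cd]] := exps s (fsubset_refl _).
have [c' [d' cd']] := exps (s `\ v)%fset (fsubD1set _ _).
have : \sum_(a <- s) l a * ((dotp c a + d) - (dotp c' a + d')) = 0.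
  under eq_bigr do rewrite mulrBr.
  by rewrite sumrB !affine_sum l0 l1 !dotp0r !mulr0 !addr0 subrr.
rewrite (big_fsetD1 v)//= big1_seq ?addr0 => [|a /= avs].
  move=> /eqP; rewrite mulf_eq0 => /orP[/eqP//|].
  have [_ [_ /(_ vs) ->]] := cd v (sE _ vs).
  rewrite subr_eq0 => /eqP/esym; have [_ [h _]] := cd' v (sE _ vs).
  by move=> /h; rewrite in_fsetD1 eqxx.
have /fsetD1P[av as_] := avs.
have [_ [_ /(_ as_) ->]] := cd a (sE _ as_).
by have [_ [_ /(_ avs) ->]] := cd' a (sE _ as_); rewrite subrr mulr0.
Qed.

(** Write [x] as a combination over [s] and over [t]. The first shows that the function of [t] is at
    most that of [s] at [x]; hence the weighted gaps of the second to the function of [s] sum to 0,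
    and vertices of [t] with positive weight lie in [s]. *)
Lemma exposed_convex_hullI s t : (s `<=` E)%fset -> (t `<=` E)%fset ->
  exposed s -> exposed t ->
  convex_hull [set` s] `&` convex_hull [set` t] = convex_hull [set` (s `&` t)%fset].
Proof.
move=> /fsubsetP sE /fsubsetP tE [c [d cd]] [c' [d' cd']].
apply/seteqP; split => [x [/convex_hull_fsetP[l [l0 l1 xl]]]|]; last first.
  move=> x xst; split; apply: le_convex_hull xst => v /=;
    by rewrite in_fsetI => /andP[].
move=> /convex_hull_fsetP[m [m0 m1 xm]].
have wl : \sum_(v <- s) l v * w v = dotp c x + d.
  rewrite xl -[d]mulr1 -l1 -affine_sum; apply: eq_big_seq => v vs.
  by have [_ [_ ->]] := cd v (sE _ vs).
have wm : \sum_(v <- t) m v * w v = dotp c' x + d'.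
  rewrite xm -[d']mulr1 -m1 -affine_sum; apply: eq_big_seq => v vt.
  by have [_ [_ ->]] := cd' v (tE _ vt).
have lm : dotp c' x + d' <= dotp c x + d.
  rewrite -wl xl -[d']mulr1 -l1 -affine_sum big_seq [leRHS]big_seq.
  by apply: ler_sum => v vs; rewrite ler_wpM2l ?l0//; have [] := cd' v (sE _ vs).
have gap v : v \in t -> 0 <= m v * (w v - (dotp c v + d)).
  by move=> vt; rewrite mulr_ge0 ?m0// subr_ge0; have [] := cd v (tE _ vt).
have gap0 : \sum_(v <- t) m v * (w v - (dotp c v + d)) == 0.
  rewrite eq_le; apply/andP; split; last by rewrite big_seq sumr_ge0.
  under eq_bigr do rewrite mulrBr.
  by rewrite sumrB wm affine_sum -xm m1 mulr1 subr_le0.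
have ms v : v \in t -> 0 < m v -> v \in s.
  move=> vt mv; have [_ [h _]] := cd v (tE _ vt); apply: h.
  move: gap0; rewrite big_seq psumr_eq0// => /allP/(_ _ vt).
  by rewrite vt mulf_eq0 gt_eqF//= subr_eq0 => /eqP.
rewrite xm; apply: convex_set_sum => //; first exact: convex_convex_hull.
by move=> v vt mv; apply: subset_convex_hull => /=; rewrite in_fsetI vt ms.
Qed.

Let lift a : 'rV[R]_(n + 1) := row_mx a (w a)%:M.

(** On a lifted point [C] equals [k * d] plus [k] times the gap between height and affine function,
    so its minimizers are the combinations of lifted points of [s]. The factor [k] accommodates
    functionals with any positive last coefficient. *)
Lemma lower_face_exposed s (c : 'rV[R]_n) (d k : R) : 0 < k ->
  (s `<=` E)%fset -> s != fset0 ->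
  (forall a, a \in E -> dotp c a + d <= w a /\ (dotp c a + d = w a <-> a \in s)) ->
  let Q := convex_hull [set lift a | a in [set` E]] in
  let C := row_mx (- k *: c) (k%:M : 'M[R]_1) in
  lsubmx @` [set y | Q y /\ forall z, Q z -> dotp C y <= dotp C z] =
  convex_hull [set` s].
Proof.
move=> k0 /fsubsetP sE /fset0Pn[a0 a0s] cd Q C.
have CE a : dotp C (lift a) = k * (w a - (dotp c a + d)) + k * d.
  rewrite dotp_row_mx dotpC dotpZr dotpC {2}/dotp big_ord1 !mxE/= !mulr1n; ring.
have lsub_sum l t : lsubmx (\sum_(a <- t) l a *: lift a) = \sum_(a <- t) l a *: a.
  by rewrite linear_sum/=; apply: eq_bigr => a _; rewrite linearZ/= row_mxKl.
have Qge z : Q z -> k * d <= dotp C z.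
  have : Q `<=` [set z | dotp (- C) z <= - (k * d)].
    apply: convex_hull_sub; first exact: convex_halfspace.
    move=> _ [a aE <-] /=; rewrite dotpC -scaleN1r dotpZr mulN1r lerN2 dotpC CE.
    by rewrite lerDr mulr_ge0 ?(ltW k0)// subr_ge0; have [] := cd a aE.
  by move=> QC /QC /=; rewrite dotpC -scaleN1r dotpZr mulN1r lerN2 dotpC.
have Qs a : a \in s -> dotp C (lift a) = k * d.
  move=> sa; rewrite CE; have [_ [_ ->//]] := cd a (sE _ sa).
  by rewrite subrr mulr0 add0r.
apply/seteqP; split => [_ [y [Qy ymin] <-]|x].
  have {ymin} : dotp C y <= k * d.
    rewrite -(Qs _ a0s); apply: ymin; apply: subset_convex_hull.
    by exists a0 => //=; exact: sE.
  move: Qy => /convex_hull_imageP[l [l0 l1 ->]] yle.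
  have gap v : v \in E -> 0 <= l v * (w v - (dotp c v + d)).
    by move=> vE; rewrite mulr_ge0 ?l0// subr_ge0; have [] := cd v vE.
  have gap0 : \sum_(v <- E) l v * (w v - (dotp c v + d)) == 0.
    rewrite eq_le; apply/andP; split; last by rewrite big_seq sumr_ge0.
    rewrite -(pmulr_rle0 _ k0) mulr_sumr.
    move: yle; rewrite dotp_sumr; under eq_bigr do rewrite dotpZr CE mulrDr.
    rewrite big_split/= -mulr_suml l1 mul1r -lerBrDr subrr.
    by under eq_bigr do rewrite mulrCA.
  rewrite lsub_sum.
  apply: convex_set_sum => //; first exact: convex_convex_hull.
  move=> a aE la; apply: subset_convex_hull => /=.
  have [_ [h _]] := cd a aE; apply: h.
  move: gap0; rewrite big_seq psumr_eq0// => /allP/(_ _ aE).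
  by rewrite aE mulf_eq0 gt_eqF//= subr_eq0 => /eqP.
move=> /convex_hull_fsetP[l [l0 l1 ->]].
exists (\sum_(a <- s) l a *: lift a); last first.
  by rewrite lsub_sum.
split.
  apply: convex_set_sum => //; first exact: convex_convex_hull.
  by move=> a sa _; apply: subset_convex_hull; exists a => //=; exact: sE.
move=> z /Qge; apply: le_trans; rewrite dotp_sumr big_seq.
under eq_bigr => a sa do rewrite dotpZr Qs//.
by rewrite -big_seq -mulr_suml l1 mul1r.
Qed.

Lemma exposed_regular (P : set 'rV[R]_n) (K : {fset {fset 'rV[R]_n}}) :
  E != fset0 -> P `&` @lattice_point R n = [set` E] ->
  (forall s, s \in K -> s != fset0 -> (s `<=` E)%fset /\ exposed s) ->
  (forall s, (s `<=` E)%fset -> exposed s -> s \in K) ->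
  regular P K.
Proof.
move=> /fset0Pn[e0 e0E] PE Kexp expK; exists w.
rewrite /lifted_polytope PE -/lift.
apply/seteqP; split => [_ [s [sK s0] <-]|_ [_ [c [c0 ->]] <-]].
  have [sE [c [d cd]]] := Kexp s sK s0.
  rewrite -(lower_face_exposed ltr01 sE s0 cd); eexists; last reflexivity.
  exists (row_mx (- 1 *: c) (1%:M : 'M[R]_1)); split => //.
  by rewrite row_mxEr !mxE ltr01.
(* Conversely, normalizing the functional of a lower face gives the slope [c']; the constant [g a0]
   is the largest one keeping the affine function below the heights, and [s] is where it touches
   them. *)
pose k := c 0 (rshift n ord0).
pose c' : 'rV[R]_n := - k^-1 *: lsubmx c.
pose g (a : E) := w (val a) - dotp c' (val a).
pose a0 := [arg min_(a < [` e0E]%fset) g a]%O.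
have gmin (b : E) : g a0 <= g b.
  by rewrite /a0; case: Order.TotalTheory.arg_minP => // ? _; exact.
pose s := [fset a in E | (dotp c' a + g a0 == w a)%R]%fset.
have sE : (s `<=` E)%fset by apply/fsubsetP => a; rewrite !inE => /andP[].
have s0 : s != fset0.
  apply/fset0Pn; exists (val a0); rewrite inE; apply/andP; split; first exact: fsvalP.
  by rewrite /= /g addrC subrK.
have cd a : a \in E -> dotp c' a + g a0 <= w a /\
    (dotp c' a + g a0 = w a <-> a \in s).
  move=> aE; split; last by rewrite !inE aE/=; split => /eqP.
  by have := gmin [` aE]%fset; rewrite {2}/g/= lerBrDl.
exists s; first by split => //; apply: expK => //; exists c', (g a0).
rewrite -(lower_face_exposed c0 sE s0 cd).
suff <- : c = row_mx (- c 0 (rshift n ord0) *: c') ((c 0 (rshift n ord0))%:M) by [].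
rewrite -[LHS]hsubmxK; congr row_mx.
  by rewrite /c' scalerA mulrNN divff ?scale1r// gt_eqF.
by apply/rowP => i; rewrite ord1 !mxE eqxx mulr1n.
Qed.

End Exposed.

(** * Volume of unimodular simplices *)

Section Volume.
Variable R : realType.
Local Notation mu := (@lebesgue_measure R).

Lemma volume_ge0 n (A : set 'rV[R]_n) : (0 <= volume A)%E.
Proof.
elim: n A => [|n IH] A /=; first by rewrite lee_fin indicE ler0n.
by apply: integral_ge0 => t _; exact: IH.
Qed.

Lemma dotp_row_mx1 n (a : 'rV[R]_(1 + n)) (t : R) (y : 'rV[R]_n) :
  dotp a (row_mx t%:M y) = a 0 0 * t + dotp (rsubmx a) y.
Proof.
rewrite -[a in LHS]hsubmxK dotp_row_mx; congr (_ + _).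
rewrite /dotp big_ord1 !mxE eqxx mulr1n; congr (a 0 _ * t).
exact: val_inj.
Qed.

(** The constant terms depend on a parameter so that induction applies: the coordinate integrated
    last joins the parameter, and Tonelli makes the partial integral measurable. *)
Lemma measurable_volume_polyhedron n d (T : measurableType d) (I : finType)
    (f : I -> T -> R) (a : I -> 'rV[R]_n) :
  (forall i, measurable_fun setT (f i)) ->
  measurable_fun setT ((fun t =>
    volume [set x : 'rV[R]_n | forall i, 0 <= f i t + dotp (a i) x]) : T -> \bar R).
Proof.
elim: n d T f a => [|n IH] d T f a mf /=.
  apply/measurable_EFinP.
  rewrite (_ : (fun _ => _) =
      \1_(\bigcap_(i in [set: I]) (f i @^-1` [set r | 0 <= r + dotp (a i) 0]))).
    apply: measurable_indic; apply: fin_bigcap_measurable => // i _.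
    rewrite -[X in measurable X]setTI; apply: mf => //.
    rewrite dotp0r (_ : [set r | _] = `[0, +oo[%classic) //.
    by apply/seteqP; split => r /=; rewrite in_itv/= andbT addr0.
  apply/funext => t; rewrite !indicE; congr (_%:R); congr (nat_of_bool _).
  by apply/idP/idP; rewrite !inE => h i; [move=> _; exact: h|exact: h].
pose g (z : T * R) := volume [set y : 'rV[R]_n |
  forall i, 0 <= (f i z.1 + a i 0 0 * z.2) + dotp (rsubmx (a i : 'rV_(1 + n))) y].
have mg : measurable_fun setT g.
  apply: IH => i; apply: measurable_funD.
    exact: measurableT_comp (mf i) measurable_fst.
  exact: measurable_funM.
have := measurable_fun_fubini_tonelli_F (m2 := mu) g mg (fun z => volume_ge0 _).
congr (measurable_fun _ _); apply/funext => t; apply: eq_integral => s _.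
rewrite /g/=; congr volume; apply/seteqP.
by split => y /= h i; have := h i; rewrite dotp_row_mx1 addrA.
Qed.

(** * Slicing along an arbitrary coordinate *)

Definition insert_coord n (j : 'I_n.+1) (s : R) (y : 'rV[R]_n) : 'rV[R]_n.+1 :=
  \row_k (if unlift j k is Some k' then y 0 k' else s).

Lemma insert_coord_same n (j : 'I_n.+1) s (y : 'rV[R]_n) : insert_coord j s y 0 j = s.
Proof. by rewrite mxE unlift_none. Qed.

Lemma insert_coord_lift n (j : 'I_n.+1) s (y : 'rV[R]_n) k :
  insert_coord j s y 0 (lift j k) = y 0 k.
Proof. by rewrite mxE liftK. Qed.

Lemma insert_coord0 n s (y : 'rV[R]_n) : insert_coord ord0 s y = row_mx s%:M y.
Proof.
apply/rowP => k; rewrite mxE; case: (unliftP ord0 k) => [k'|] ->.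
  have -> : lift ord0 k' = rshift 1 (k' : 'I_n) by exact: val_inj.
  exact/esym/(@row_mxEr _ 1 1 n).
have -> : ord0 = @lshift 1 n ord0 by exact: val_inj.
by apply/esym; rewrite (@row_mxEl _ 1 1 n) mxE eqxx mulr1n.
Qed.

Lemma insert_coord_lift0 n (j : 'I_n.+1) s t (y : 'rV[R]_n) :
  insert_coord (lift ord0 j) s (insert_coord ord0 t y) =
  insert_coord ord0 t (insert_coord j s y).
Proof.
apply/rowP => k.
case: (unliftP ord0 k) => [k'|] ->; last first.
  rewrite insert_coord_same mxE.
  case: (unliftP (lift ord0 j) ord0) => [k1 /esym e|/(congr1 val)//].
  have -> : k1 = ord0.
    by apply/val_inj; move/(congr1 val) : e; rewrite /= /bump; case: leqP.
  by rewrite insert_coord_same.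
rewrite insert_coord_lift.
case: (unliftP j k') => [l|] ->; last by rewrite !insert_coord_same.
rewrite insert_coord_lift.
rewrite [lift ord0 (lift j l)](_ : _ = lift (lift ord0 j) (lift ord0 l)).
  by rewrite !insert_coord_lift.
by apply/val_inj; rewrite /= /bump /= !add1n ltnS addnS.
Qed.

Lemma dotp_insert_coord n (j : 'I_n.+1) (a : 'rV[R]_n.+1) s (y : 'rV[R]_n) :
  dotp a (insert_coord j s y) = a 0 j * s + dotp (\row_k a 0 (lift j k)) y.
Proof.
rewrite /dotp (bigD1_ord j)//= insert_coord_same; congr (_ + _).
by apply: eq_bigr => k _; rewrite insert_coord_lift mxE.
Qed.

Lemma volumeS n (B : set 'rV[R]_n.+1) :
  volume B = (\int[mu]_t volume [set y | B (insert_coord ord0 t y)])%E.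
Proof.
apply: eq_integral => s _; congr volume; apply/funext => y.
by rewrite -[RHS]/(B (insert_coord ord0 s y)) insert_coord0.
Qed.

(** By induction the inner volume can be sliced along [j], and Tonelli then exchanges this integral
    with that over the first coordinate. Restricting to polyhedra provides the measurability. *)
Lemma volume_slice n (j : 'I_n.+1) (I : finType) (b : I -> R) (a : I -> 'rV[R]_n.+1) :
  let A := [set x | forall i, 0 <= b i + dotp (a i) x] in
  volume A = (\int[mu]_s volume [set y | A (insert_coord j s y)])%E.
Proof.
elim: n j b a => [|n IH] j b a A; first by rewrite (ord1 j); exact: volumeS.
case: (unliftP ord0 j) => [j'|] ->; last exact: volumeS.
rewrite volumeS.
have dE i s y : dotp (\row_k a i 0 (lift ord0 k)) (insert_coord j' s y) =
    a i 0 (lift ord0 j') * s + dotp (\row_k a i 0 (lift ord0 (lift j' k))) y.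
  rewrite dotp_insert_coord mxE; congr (_ + dotp _ _).
  by apply/rowP => k; rewrite !mxE.
pose g (z : R * R) := volume [set y : 'rV[R]_n |
  forall i, 0 <= (b i + a i 0 ord0 * z.1 + a i 0 (lift ord0 j') * z.2) +
    dotp (\row_k a i 0 (lift ord0 (lift j' k))) y].
have mg : measurable_fun setT g.
  apply: measurable_volume_polyhedron => i.
  by apply: measurable_funD; [apply: measurable_funD|] => //; exact: measurable_funM.
transitivity (\int[mu]_t \int[mu]_s g (t, s))%E.
  apply: eq_integral => t _.
  rewrite (_ : [set y | _] = [set y : 'rV[R]_n.+1 | forall i, 0 <= (b i + a i 0 ord0 * t) +
      dotp (\row_k a i 0 (lift ord0 k)) y]); last first.
    by apply/seteqP; split => y /= h i; have := h i; rewrite dotp_insert_coord addrA.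
  rewrite (IH j'); apply: eq_integral => s _; rewrite /g; congr volume.
  by apply/seteqP; split => y /= h i; have := h i; rewrite dE !addrA.
transitivity (\int[mu]_s \int[mu]_t g (t, s))%E.
  exact: (fubini_tonelli (m1 := mu) (m2 := mu) g mg (fun z => volume_ge0 _)).
apply: eq_integral => s _; rewrite volumeS; apply: eq_integral => t _.
rewrite /g; congr volume; apply/funext => y.
rewrite -[RHS]/(A (insert_coord (lift ord0 j') s (insert_coord ord0 t y))).
rewrite insert_coord_lift0 /A /=; apply/propext.
by split => h i; have := h i; rewrite dotp_insert_coord dE !addrA.
Qed.

Lemma integral_deriv_poly (p : {poly R}) (a b : R) : a <= b ->
  (\int[mu]_(x in `[a, b]) (p^`().[x])%:E = (p.[b] - p.[a])%:E)%E.
Proof.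
rewrite le_eqVlt => /predU1P[->|ab].
  by rewrite set_itv1 integral_set1 subrr.
rewrite (@continuous_FTC2 _ (horner p^`()) (horner p))//.
- exact/continuous_subspaceT/continuous_horner.
- split.
  + by move=> x _; exact: derivable_horner.
  + by apply: cvg_at_right_filter; exact: continuous_horner.
  + by apply: cvg_at_left_filter; exact: continuous_horner.
- by move=> x _; rewrite derivE.
Qed.

(** This is the induction step of the volume computation: the slice of a simplex of size [c] is one
    of size [c - e * (s - p)], and is empty outside the stated range. *)
Lemma integral_affine_power n (p e c : R) : (e = 1 \/ e = -1) -> 0 <= c ->
  (\int[mu]_s (if (0 <= e * (s - p) <= c)%R
    then ((c - e * (s - p)) ^+ n / n`!%:R)%R%:E else 0) =
  (c ^+ n.+1 / n.+1`!%:R)%:E)%E.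
Proof.
move=> e1 c0.
have ee : e * e = 1 by case: e1 => ->; rewrite ?mulrNN mulr1.
pose q : {poly R} := c%:P - e *: ('X - p%:P).
have qE s : q.[s] = c - e * (s - p) by rewrite !hornerE.
have dq : q^`() = (- e)%:P.
  by rewrite derivB derivC derivZ derivXsubC sub0r -scaleNr alg_polyC.
clearbody q.
(* An antiderivative of the integrand: the derivative of [q] is [- e], and [e * e = 1]. *)
pose P : {poly R} := (- e / n.+1`!%:R) *: q ^+ n.+1.
have dP s : P^`().[s] = (c - e * (s - p)) ^+ n / n`!%:R.
  rewrite derivZ deriv_exp dq hornerZ hornerMn hornerM hornerC horner_exp qE /=.
  rewrite factS natrM invfM; set X := _ ^+ n.
  have n0 : n.+1%:R != 0 :> R by rewrite pnatr_eq0.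
  have f0 : n`!%:R != 0 :> R by rewrite pnatr_eq0 -lt0n fact_gt0.
  transitivity (e * e * (X / n`!%:R)); last by rewrite ee mul1r.
  by rewrite -mulr_natr; field; rewrite f0 addrC natr1 n0.
have PE s : P.[s] = (- e / n.+1`!%:R) * (c - e * (s - p)) ^+ n.+1.
  by rewrite hornerZ horner_exp qE.
have [a [b [ab abE Pab]]] : exists a b, [/\ a <= b,
    forall s, (s \in `[a, b]) = (0 <= e * (s - p) <= c) &
    P.[b] - P.[a] = c ^+ n.+1 / n.+1`!%:R].
  case: e1 => e1.
    exists p, (p + c); split; first by rewrite lerDl.
      by move=> s; rewrite in_itv/= e1 mul1r subr_ge0 lerBlDl.
    rewrite !PE e1 !mul1r subrr addrAC subrr add0r subrr expr0n/= subr0.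
    by rewrite mulr0 sub0r mulN1r mulNr opprK mulrC.
  exists (p - c), p; split; first by rewrite gerBl.
    move=> s; rewrite in_itv/= e1 mulN1r opprB subr_ge0 andbC.
    by rewrite lerBlDr lerBlDl addrC.
  rewrite !PE e1 subrr mulr0 subr0 opprK !mul1r.
  have -> : c - -1 * (p - c - p) = 0 by ring.
  by rewrite expr0n mulr0 subr0 mulrC.
rewrite -Pab -integral_deriv_poly// [RHS]integral_mkcond.
apply: eq_integral => s _; rewrite patchE mem_setE abE dP.
by case: ifP.
Qed.

(** * Simplices spanned by triangular matrices *)

(* Triangular once rows and columns are simultaneously sorted by [r], in any
   order among ties. *)
Definition unitriangular n (V : 'M[R]_n) (r : 'I_n -> nat) : Prop :=
  (forall i, V i i = 1 \/ V i i = -1) /\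
  (forall i j, i != j -> V j i != 0 -> (r i < r j)%N).

(** An index [j] of largest rank works, since a nonzero entry of column [j] in another row [k] would
    force [r j < r k]. *)
Lemma unitriangular_last n (V : 'M[R]_n.+1) r : unitriangular V r ->
  exists j, (forall k, k != j -> V k j = 0) /\
    unitriangular (row' j (col' j V)) (r \o lift j).
Proof.
move=> [Vii Vr]; pose j := [arg max_(i > ord0 | true) r i]%N.
have jmax k : (r k <= r j)%N by rewrite /j; case: arg_maxnP => // i _; exact.
exists j; split => [k kj|].
  apply/eqP/negP => /negP Vkj.
  by have := Vr j k; rewrite eq_sym => /(_ kj Vkj); rewrite ltnNge jmax.
split => [i|i k ik]; rewrite !mxE//= => Vki.
by apply: Vr => //; rewrite (inj_eq lift_inj).
Qed.

Lemma unitriangular_det n (V : 'M[R]_n) r : unitriangular V r -> \det V != 0.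
Proof.
elim: n V r => [|n IH] V r Vr; first by rewrite det_mx00 oner_eq0.
have [j [Vj /IH Vdet]] := unitriangular_last Vr.
rewrite (expand_det_col _ j) (bigD1 j)//= big1 ?addr0 => [|k kj]; last first.
  by rewrite Vj// mul0r.
rewrite mulf_neq0 ?/cofactor//; last by rewrite mulf_neq0// signr_eq0.
by have [/(_ j) [] -> _] := Vr; rewrite ?oppr_eq0 oner_eq0.
Qed.

(** The corner [p] and the size [c] are kept general because slicing changes both. *)
Definition corner_simplex n (p : 'rV[R]_n) (V : 'M[R]_n) (c : R) : set 'rV[R]_n :=
  [set x | exists l : 'rV[R]_n, [/\ forall i, 0 <= l 0 i,
    \sum_i l 0 i <= c & x = p + l *m V]].

(** The weights are recovered as [(x - p) *m invmx V], which turns the conditions on them into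
    linear inequalities in [x]; [None] indexes the bound on their sum. *)
Lemma corner_simplex_polyhedron n (p : 'rV[R]_n) (V : 'M[R]_n) (c : R) :
  V \in unitmx -> exists (b : option 'I_n -> R) (a : option 'I_n -> 'rV[R]_n),
  corner_simplex p V c = [set x | forall i, 0 <= b i + dotp (a i) x].
Proof.
move=> Vu; pose W := invmx V.
pose b o := if o is Some i then - (p *m W) 0 i else c + \sum_i (p *m W) 0 i.
pose a o : 'rV[R]_n := if o is Some i then \row_k W k i else - \row_k \sum_i W k i.
have aS x i : b (Some i) + dotp (a (Some i)) x = ((x - p) *m W) 0 i.
  rewrite mulmxBl mxE addrC; congr (_ + _); first by rewrite [RHS]mxE.
  by rewrite [RHS]mxE; apply: eq_bigr => k _; rewrite mxE mulrC.
have aN x : b None + dotp (a None) x = c - \sum_i ((x - p) *m W) 0 i.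
  under eq_bigr do rewrite mulmxBl mxE [in X in _ + X]mxE.
  rewrite sumrB opprB -addrA; congr (_ + _); congr (_ + _).
  rewrite /dotp; under eq_bigr do rewrite !mxE mulNr.
  rewrite sumrN; congr (- _); rewrite [RHS](eq_bigr (fun i => \sum_k x 0 k * W k i)).
    rewrite exchange_big/=; apply: eq_bigr => k _.
    by rewrite mulr_suml; apply: eq_bigr => i _; rewrite mulrC.
  by move=> i _; rewrite mxE.
exists b, a; apply/seteqP; split => x /=.
  move=> [l [l0 lc ->]].
  have lW : (p + l *m V - p) *m W = l by rewrite addrAC subrr add0r mulmxK.
  by case=> [i|]; rewrite ?aS ?aN lW// subr_ge0.
move=> h; exists ((x - p) *m W); split.
- by move=> i; rewrite -aS.
- by rewrite -subr_ge0 -aN.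
- by rewrite mulmxKV// addrC subrK.
Qed.

(** Column [j] is zero off the diagonal, so coordinate [j] of a point determines the weight [u] of
    row [j]. The other weights share [c - u], and the corner moves along row [j]. *)
Lemma corner_simplex_slice n (p : 'rV[R]_n.+1) (V : 'M[R]_n.+1) c j s :
  (V j j = 1 \/ V j j = -1) -> (forall k, k != j -> V k j = 0) ->
  let u := V j j * (s - p 0 j) in
  [set y | corner_simplex p V c (insert_coord j s y)] =
  if 0 <= u <= c then
    corner_simplex (\row_k (p 0 (lift j k) + u * V j (lift j k)))
      (row' j (col' j V)) (c - u)
  else set0.
Proof.
move=> Vjj Vj u.
have ee : V j j * V j j = 1 by case: Vjj => ->; rewrite ?mulrNN mulr1.
have mulj (l : 'rV[R]_n.+1) : (l *m V) 0 j = l 0 j * V j j.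
  rewrite mxE (bigD1 j)//= big1 ?addr0// => k kj.
  by rewrite Vj// mulr0.
have mull (l : 'rV[R]_n.+1) k : (l *m V) 0 (lift j k) = l 0 j * V j (lift j k) +
    ((\row_k l 0 (lift j k)) *m row' j (col' j V)) 0 k.
  rewrite !mxE (bigD1_ord j)//=; congr (_ + _).
  by apply: eq_bigr => i _; rewrite !mxE.
apply/seteqP; split => y /=.
  move=> [l [l0 lc yE]].
  have lj : l 0 j = u.
    have := congr1 (fun x : 'rV[R]_n.+1 => x 0 j) yE.
    rewrite insert_coord_same mxE mulj => sE.
    by rewrite /u sE addrAC subrr add0r mulrCA ee mulr1.
  have lS : \sum_i l 0 i = u + \sum_k l 0 (lift j k).
    by rewrite (bigD1_ord j)//= lj.
  have u0 : 0 <= u by rewrite -lj.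
  have uc : u <= c.
    apply: le_trans lc; rewrite lS lerDl sumr_ge0// => i _; exact: l0.
  rewrite u0 uc /=; exists (\row_k l 0 (lift j k)); split.
  - by move=> i; rewrite mxE.
  - by under eq_bigr do rewrite mxE; rewrite lerBrDl -lS.
  - apply/rowP => k; have := congr1 (fun x : 'rV[R]_n.+1 => x 0 (lift j k)) yE.
    by rewrite insert_coord_lift [in X in X -> _]mxE mull lj addrA => ->; rewrite !mxE.
case: ifP => // /andP[u0 uc] [l [l0 lc yE]].
exists (insert_coord j u l); split.
- move=> i; rewrite mxE; case: unlift => //= k; exact: l0.
- rewrite (bigD1_ord j)//= insert_coord_same.
  by under eq_bigr do rewrite insert_coord_lift; rewrite -lerBrDl.
- apply/rowP => i; case: (unliftP j i) => [k|] ->.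
    rewrite insert_coord_lift [RHS]mxE mull yE insert_coord_same.
    rewrite [LHS]mxE [X in X + _]mxE -addrA; congr (_ + (_ + _)).
    congr ((_ *m _) 0 k); apply/rowP => m.
    by rewrite mxE insert_coord_lift.
  rewrite !insert_coord_same mxE mulj insert_coord_same /u mulrAC ee mul1r.
  by rewrite addrC subrK.
Qed.

Lemma volume_corner_simplex n (p : 'rV[R]_n) (V : 'M[R]_n) r c :
  unitriangular V r -> 0 <= c ->
  volume (corner_simplex p V c) = (c ^+ n / n`!%:R)%:E.
Proof.
elim: n p V r c => [|n IH] p V r c Vr c0.
  rewrite /= indicE mem_set; first by rewrite expr0 fact0 divr1.
  exists 0; split => [i||]; last by apply/rowP => -[].
    by rewrite mxE.
  by rewrite big_ord0.
have Vu : V \in unitmx by rewrite unitmxE unitfE (unitriangular_det Vr).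
have [j [Vj Vj']] := unitriangular_last Vr.
have Vjj := Vr.1 j.
have [b [a pE]] := corner_simplex_polyhedron p c Vu.
rewrite pE (volume_slice j) -pE -(integral_affine_power n (p 0 j) Vjj c0).
apply: eq_integral => s _; rewrite corner_simplex_slice//.
case: ifP => [/andP[u0 uc]|_]; first by rewrite (IH _ _ _ _ Vj')// subr_ge0.
suff : forall m, volume (set0 : set 'rV[R]_m) = 0%E by apply.
elim => [|m IHm] /=; first by rewrite indicE in_set0.
rewrite (eq_integral (cst 0%E)); first by rewrite integral0.
by move=> t _; rewrite -[RHS]IHm.
Qed.

Lemma convex_hull_corner n (V : 'M[R]_n) (s : {fset 'rV[R]_n}) :
  (forall v, v \in s <-> v = 0 \/ exists i, v = row i V) ->
  convex_hull [set` s] = corner_simplex 0 V 1.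
Proof.
move=> sE; apply/seteqP; split.
  apply: convex_hull_sub => [|v /= /sE].
    apply/convex_setP => _ _ t [l [l0 l1 ->]] [m [m0 m1 ->]] /andP[t0 t1].
    have t1' : 0 <= 1 - t by rewrite subr_ge0.
    exists (t *: l + (1 - t) *: m); split.
    - by move=> i; rewrite !mxE addr_ge0 ?mulr_ge0.
    - under eq_bigr do rewrite !mxE; rewrite big_split/= -!mulr_sumr.
      by have := ler_wpM2l t0 l1; have := ler_wpM2l t1' m1; lra.
    - by rewrite !add0r mulmxDl !scalemxAl.
  move=> [->|[i ->]].
    exists 0; split; first by move=> i; rewrite mxE.
      by rewrite big1 ?ler01// => i _; rewrite mxE.
    by rewrite mul0mx addr0.
  exists (delta_mx 0 i); split.
  - by move=> j; rewrite mxE ler0n.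
  - rewrite (bigD1 i)//= mxE !eqxx big1 ?addr0// => j /negPf ji.
    by rewrite mxE ji andbF.
  - by rewrite add0r rowE.
move=> _ [l [l0 l1 ->]]; rewrite add0r mulmx_sum_row.
(* [None] stands for the origin, which receives the weight missing to 1. *)
pose L o := if o is Some i then l 0 i else 1 - \sum_i l 0 i.
pose f o : 'rV[R]_n := if o is Some i then row i V else 0.
have -> : \sum_i l 0 i *: row i V =
    \sum_(o <- None :: map Some (index_enum 'I_n)) L o *: f o.
  by rewrite big_cons big_map scaler0 add0r.
apply: convex_set_sum => [|o||o].
- exact: convex_convex_hull.
- by rewrite in_cons => /predU1P[->|/mapP[i _ ->]]; rewrite /= ?subr_ge0.
- by rewrite big_cons big_map subrK.
- rewrite in_cons => /predU1P[->|/mapP[i _ ->]] _; apply: subset_convex_hull;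
  apply/sE; [by left|by right; exists i].
Qed.

End Volume.

(** * Signed antichains *)

Section EnrichedPoints.
Variables (R : realType) (n : nat).
Implicit Types (le : rel 'I_n) (x v : 'rV[R]_n).

Definition supp x : {set 'I_n} := [set i | x 0 i != 0].

(** Being fixed by [Num.sg] means having entries 0, 1 and -1. This form avoids the sign function
    [e], whose values off the antichain are arbitrary. *)
Lemma enriched_pointsP le x : enriched_points R le x <->
  (forall i, Num.sg (x 0 i) = x 0 i) /\ antichain le (supp x).
Proof.
split=> [[A [e [Aanti ->]]]|[xs xanti]].
  set y := \sum_(i in A) _.
  have yE i : y 0 i = if i \in A then (-1) ^+ e i else 0.
    rewrite summxE; case: ifP => iA.
      rewrite (bigD1 i)//= !mxE !eqxx mulr1 big1 ?addr0// => j /andP[_ ji].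
      by rewrite !mxE eqxx eq_sym (negPf ji) mulr0.
    rewrite big1// => j jA; rewrite !mxE eqxx.
    by have /negPf -> : i != j; rewrite ?mulr0//; apply: contraFneq iA => ->.
  have -> : supp y = A.
    by apply/setP => i; rewrite inE yE; case: ifP; rewrite ?eqxx// signr_eq0.
  split => // i; rewrite yE; case: ifP => _; last exact: sgr0.
  by rewrite sgrX sgrN sgr1.
exists (supp x), (fun i => x 0 i < 0); split => //.
apply/rowP => i; rewrite summxE; have [xi|xi] := eqVneq (x 0 i) 0.
  rewrite xi big1// => j; rewrite inE !mxE eqxx => xj.
  have /negPf -> : i != j by apply: contraNneq xj => <-; rewrite xi.
  by rewrite mulr0.
rewrite (bigD1 i) ?inE//= big1 ?addr0 => [|j /andP[_ ji]]; last first.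
  by rewrite !mxE eqxx eq_sym (negPf ji) mulr0.
by rewrite !mxE !eqxx mulr1 -{1}xs neqr0_sign.
Qed.

Lemma finite_enriched_points le : finite_set (enriched_points R le).
Proof.
pose f (Ae : {set 'I_n} * {ffun 'I_n -> bool}) : 'rV[R]_n :=
  \sum_(i in Ae.1) (-1) ^+ Ae.2 i *: delta_mx 0 i.
apply: (@sub_finite_set _ _ (range f)); last exact: finite_image.
move=> _ [A [e [_ ->]]]; exists (A, [ffun i => e i]) => //.
by apply: eq_bigr => i _; rewrite ffunE.
Qed.

Lemma enriched_points_lattice le : enriched_points R le `<=` @lattice_point R n.
Proof.
move=> x /enriched_pointsP[xs _] /=; apply/mxOverP => i j; rewrite (ord1 i) -xs.
by rewrite sgr_def rpredMn// rpred_sign.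
Qed.

Lemma enriched_points0 le : enriched_points R le 0.
Proof.
apply/enriched_pointsP; split => [i|i j]; first by rewrite mxE sgr0.
by rewrite inE mxE eqxx.
Qed.

Lemma supp_delta i : supp (delta_mx 0 i) = [set i]%SET.
Proof. by apply/setP => j; rewrite !inE mxE eqxx/= pnatr_eq0 eqb0 negbK. Qed.

Lemma enriched_points_delta le i : enriched_points R le (delta_mx 0 i).
Proof.
apply/enriched_pointsP; rewrite supp_delta; split => [j|j k].
  by rewrite mxE eqxx/=; case: eqP; rewrite ?sgr1 ?sgr0.
by rewrite !inE => /eqP -> /eqP ->; rewrite eqxx.
Qed.

Lemma enriched_points_eq1 le x i : enriched_points R le x -> x 0 i != 0 ->
  x 0 i * x 0 i = 1.
Proof. by move=> /enriched_pointsP[xs _] xi; rewrite -xs -expr2 sqr_sg xi. Qed.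

Lemma antichain_sub le (A B : {set 'I_n}) : A \subset B -> antichain le B -> antichain le A.
Proof. by move=> /fintype.subsetP AB Ble i j /AB iA /AB; exact: Ble. Qed.

(* Antichains of this relation are the chains of [le], so its [enriched_points]
   are the signed chains, whose hull is the dual polytope. *)
Definition incomparability le : rel 'I_n :=
  fun i j => (i == j) || ~~ (le i j || le j i).

Lemma chainP le (C : {set 'I_n}) : reflexive le ->
  antichain (incomparability le) C <->
  forall i j, i \in C -> j \in C -> le i j || le j i.
Proof.
move=> le_refl; split => Cle i j iC jC.
  have [->|ij] := eqVneq i j; first by rewrite le_refl.
  by have [] := Cle i j iC jC ij; rewrite /incomparability (negPf ij)/= negbK.
move=> ij; rewrite /incomparability [j == i]eq_sym (negPf ij)/= !negbK.
by split; [exact: Cle|rewrite orbC; apply: Cle].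
Qed.

(** A chain and an antichain share at most one element, so a single product survives. *)
Lemma dotp_chain_antichain le x z i : enriched_points R le x ->
  enriched_points R (incomparability le) z -> x 0 i != 0 -> z 0 i != 0 ->
  dotp z x = z 0 i * x 0 i.
Proof.
move=> /enriched_pointsP[_ xle] /enriched_pointsP[_ zle] xi zi.
rewrite /dotp (bigD1 i)//= big1 ?addr0// => j ji.
have [xj|xj] := eqVneq (x 0 j) 0; first by rewrite xj mulr0.
have [zj|zj] := eqVneq (z 0 j) 0; first by rewrite zj mul0r.
have := xle i j; rewrite !inE xi xj eq_sym ji => /(_ isT isT isT)[nij nji].
have := zle i j; rewrite !inE zi zj eq_sym ji => /(_ isT isT isT)[].
by rewrite /incomparability eq_sym (negPf ji)/= negb_or nij nji.
Qed.

Lemma dotp_disjoint (z x : 'rV[R]_n) : (forall i, z 0 i != 0 -> x 0 i = 0) ->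
  dotp z x = 0.
Proof.
move=> zx; rewrite /dotp big1// => i _.
by have [->|/zx ->] := eqVneq (z 0 i) 0; rewrite ?mul0r ?mulr0.
Qed.

Lemma sgr_fix_mul_le1 (a b : R) : Num.sg a = a -> Num.sg b = b -> a * b <= 1.
Proof.
by move=> <- <-; rewrite -sgrM; case: (sgrP (a * b)); rewrite ?ler01 ?lerN10.
Qed.

End EnrichedPoints.

Section Poset.
Variables (R : realType) (n : nat) (le : rel 'I_n).
Hypotheses (le_refl : reflexive le) (le_anti : antisymmetric le)
  (le_tr : transitive le).
Implicit Types (u v x z : 'rV[R]_n) (s : {fset 'rV[R]_n}) (F Z C : {set 'I_n}).

Local Notation E := (enriched_points R le).
Local Notation E' := (enriched_points R (incomparability le)).

(** * Filters, order ideals and minimal elements *)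

Lemma le_antisym i j : le i j -> le j i -> i = j.
Proof. by move=> ij ji; apply: le_anti; rewrite ij ji. Qed.

Definition upset F := [forall i in F, forall j, le i j ==> (j \in F)].
Definition downset Z := [forall j in Z, forall i, le i j ==> (i \in Z)].

Lemma upsetP F : reflect (forall i j, i \in F -> le i j -> j \in F) (upset F).
Proof.
apply: (iffP forall_inP) => h i; last by move=> iF; apply/forallP => j; apply/implyP/h.
by move=> j iF ij; have /forallP/(_ j)/implyP := h i iF; apply.
Qed.

Lemma downsetP Z : reflect (forall i j, j \in Z -> le i j -> i \in Z) (downset Z).
Proof.
apply: (iffP forall_inP) => h j; last by move=> iF; apply/forallP => i; apply/implyP/h.
by move=> i iF ij; have /forallP/(_ j)/implyP := h i iF; apply.
Qed.

Lemma downsetC F : upset F -> downset (~: F).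
Proof.
move=> /upsetP Fup; apply/downsetP => i j; rewrite !inE => jF ij.
by apply: contra jF => iF; exact: Fup ij.
Qed.

Definition up x : {set 'I_n} := [set i | [exists j in supp x, le j i]].

Lemma upP x i : reflect (exists2 j, x 0 j != 0 & le j i) (i \in up x).
Proof.
rewrite inE; apply: (iffP exists_inP) => -[j jx ji]; exists j => //;
by move: jx; rewrite inE.
Qed.

Lemma supp_up x i : x 0 i != 0 -> i \in up x.
Proof. by move=> xi; apply/upP; exists i. Qed.

Lemma upset_up x : upset (up x).
Proof.
apply/upsetP => i j /upP[k xk ki] ij; apply/upP; exists k => //.
exact: le_tr ij.
Qed.

Lemma up_sub x y : supp x \subset supp y -> up x \subset up y.
Proof.
move=> /fintype.subsetP xy; apply/fintype.subsetP => i /upP[j xj ji].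
by apply/upP; exists j => //; have := xy j; rewrite !inE; apply.
Qed.

Lemma up0 : up 0 = finset.set0.
Proof. by apply/setP => i; rewrite finset.in_set0; apply/negP => /upP[j]; rewrite mxE eqxx. Qed.

(** An element of the support below [j] is also below [i], hence equal to it. Thus the support of a
    signed antichain consists of minimal elements of its filter. *)
Lemma supp_min x i j : E x -> x 0 i != 0 -> j \in up x -> le j i -> j = i.
Proof.
move=> /enriched_pointsP[_ xA] xi /upP[k xk kj] ji.
have [ki|ki] := eqVneq k i; first by apply: le_antisym; rewrite // -{1}ki.
have := xA k i; rewrite !inE xi xk ki => /(_ isT isT isT)[].
by rewrite (le_tr kj ji).
Qed.

(** Among the elements of [F] below [i], one with the fewest elements below it is minimal. *)
Lemma min_below (F : {set 'I_n}) i : i \in F ->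
  exists a, [/\ a \in F, le a i & forall j, j \in F -> le j a -> j = a].
Proof.
move=> iF; pose P := [pred a | (a \in F) && le a i].
have Pi : P i by rewrite /= iF le_refl.
case: (arg_minnP (fun a => #|[set j | le j a]%SET|) Pi) => a /andP[aF ai] amin.
exists a; split => // j jF ja; apply: le_antisym => //.
have := amin j; rewrite /= jF (le_tr ja ai) => /(_ isT) cle.
have sub : [set k | le k j]%SET \subset [set k | le k a]%SET.
  by apply/fintype.subsetP => k; rewrite !inE => kj; exact: le_tr ja.
have : [set k | le k j]%SET = [set k | le k a]%SET.
  by apply/eqP; rewrite eqEcard sub.
by move/setP/(_ a); rewrite !inE le_refl.
Qed.

(** * Compatibility and faces *)

Definition compat u v : Prop := (forall i, 0 <= u 0 i * v 0 i) /\
  (up u \subset up v) || (up v \subset up u).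

Definition face s : Prop := (forall v, v \in s -> E v) /\
  (forall u v, u \in s -> v \in s -> compat u v).

Lemma compat_sym u v : compat u v -> compat v u.
Proof. by move=> [uv uvF]; split => [i|]; rewrite ?[v 0 i * _]mulrC// orbC. Qed.

Lemma compat_refl u : compat u u.
Proof. by split => [i|]; rewrite ?fintype.subxx// -expr2 sqr_ge0. Qed.

Lemma compat0 u : compat 0 u.
Proof. by split => [i|]; rewrite ?mxE ?mul0r// up0 finset.sub0set. Qed.

Lemma face_sub s (t : {fset 'rV[R]_n}) : face s -> (t `<=` s)%fset -> face t.
Proof.
by move=> [sE sc] /fsubsetP ts; split => [v /ts/sE//|u v /ts us /ts]; exact: sc.
Qed.

Lemma face_cons v s : E v -> face s -> (forall u, u \in s -> compat v u) ->
  face (v |` s)%fset.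
Proof.
move=> Ev [sE sc] vs; split => [u|u1 u2].
  by rewrite in_fset1U => /predU1P[->//|]; exact: sE.
rewrite !in_fset1U => /predU1P[->|u1s] /predU1P[->|u2s].
- exact: compat_refl.
- exact: vs.
- exact/compat_sym/vs.
- exact: sc.
Qed.

(** The filter determines the support as its minimal elements, and the common orthant then
    determines the signs. *)
Lemma compat_up_eq u v : E u -> E v -> compat u v -> up u = up v -> u = v.
Proof.
move=> Eu Ev [uvs _] uv.
have suppE i : (u 0 i != 0) = (v 0 i != 0).
  wlog suff h : u v Eu Ev uv {uvs} / u 0 i != 0 -> v 0 i != 0.
    by apply/idP/idP; apply: h.
  move=> ui; have : i \in up v by rewrite -uv supp_up.
  move=> /upP[k vk ki]; suff <- : k = i by [].
  by apply: (supp_min Eu ui) => //; rewrite uv supp_up.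
apply/rowP => i; have := suppE i.
have [/enriched_pointsP[us _] /enriched_pointsP[vs _]] := (Eu, Ev).
have := uvs i; rewrite -(us i) -(vs i) !sgr_eq0.
case: (sgrP (u 0 i)) => //; case: (sgrP (v 0 i)) => // _ _.
- by rewrite mulrN1 ler0N1.
- by rewrite mulr1 ler0N1.
Qed.

(** * Heights and the exchange of incompatible points *)

Definition hits v Z := [exists i in Z, v 0 i != 0].

Definition height v : R := \sum_(Z : {set 'I_n} | downset Z) (hits v Z)%:R.

Lemma hitsP v Z : reflect (exists2 i, i \in Z & v 0 i != 0) (hits v Z).
Proof. exact: exists_inP. Qed.

(** An order ideal meeting a filter also contains one of its generators. *)
Lemma hits_up v Z : downset Z -> hits v Z = ~~ (up v \subset ~: Z).
Proof.
move=> /downsetP dZ; apply/idP/fintype.subsetPn.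
  by move=> /hitsP[i iZ vi]; exists i; rewrite ?supp_up// inE iZ.
move=> [i /upP[j vj ji]]; rewrite inE negbK => iZ.
by apply/hitsP; exists j => //; exact: dZ ji.
Qed.

Lemma hits0 Z : hits 0 Z = false.
Proof. by apply/negbTE/negP => /hitsP[i _]; rewrite mxE eqxx. Qed.

Lemma hits_sub u v Z : supp u \subset supp v -> hits u Z -> hits v Z.
Proof.
move=> /fintype.subsetP uv /hitsP[i iZ ui]; apply/hitsP; exists i => //.
by have := uv i; rewrite !inE; apply.
Qed.

Lemma hits_upC v : hits v (~: up v) = false.
Proof.
apply/negbTE/negP => /hitsP[i]; rewrite inE => /negP iv vi.
by apply: iv; exact: supp_up.
Qed.

Lemma ltr_sum_downset (f g : {set 'I_n} -> R) Z0 : downset Z0 ->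
  (forall Z, downset Z -> f Z <= g Z) -> f Z0 < g Z0 ->
  \sum_(Z | downset Z) f Z < \sum_(Z | downset Z) g Z.
Proof.
move=> dZ0 fg fgZ0; rewrite (bigD1 Z0)//= [ltRHS](bigD1 Z0)//=.
by apply: ltr_leD => //; apply: ler_sum => Z /andP[dZ _]; exact: fg.
Qed.

(** Entries of opposite sign cancel in [u + v], so deleting them from both points keeps the sum.
    Supports only shrink, hence so do the sets of ideals met. *)
Lemma exchange_orthant u v i0 : E u -> E v -> u 0 i0 * v 0 i0 < 0 ->
  exists a b, [/\ E a, E b, a + b = u + v & height a + height b < height u + height v].
Proof.
move=> Eu Ev uv0.
pose cut (x y : 'rV[R]_n) : 'rV[R]_n := \row_i (if x 0 i * y 0 i < 0 then 0 else x 0 i).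
have supp_cut x y : supp (cut x y) \subset supp x.
  by apply/fintype.subsetP => i; rewrite !inE mxE; case: ifP; rewrite ?eqxx.
have Ecut x y : E x -> E (cut x y).
  move=> /enriched_pointsP[xs xA]; apply/enriched_pointsP; split => [i|].
    by rewrite mxE; case: ifP; rewrite ?sgr0// xs.
  exact: antichain_sub xA.
exists (cut u v), (cut v u); split; [exact: Ecut|exact: Ecut| |].
  have [/enriched_pointsP[us _] /enriched_pointsP[vs _]] := (Eu, Ev).
  apply/rowP => i; rewrite !mxE [v 0 i * _]mulrC; case: ifP => // .
  rewrite -(us i) -(vs i); case: (sgrP (u 0 i)); case: (sgrP (v 0 i));
    by rewrite ?mulrNN ?(mul0r, mulr0, mul1r, mulr1) ?ltxx ?ltr10 ?addr0 ?addrN ?addNr.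
apply: ltr_leD; last first.
  apply: ler_sum => Z _; rewrite ler_nat.
  by case: (hits _ _) (hits_sub (Z := Z) (supp_cut v u)) => // /(_ isT) ->.
(* The drop is strict at this ideal: [cut u v] misses it, while [u] meets it at [i0], a minimal
   element of the filter of [u] that was deleted. *)
apply: (@ltr_sum_downset _ _ (~: up (cut u v))).
- exact/downsetC/upset_up.
- move=> Z _; rewrite ler_nat.
  by case: (hits _ _) (hits_sub (Z := Z) (supp_cut u v)) => // /(_ isT) ->.
- rewrite hits_upC ltr_nat lt0b; apply/hitsP; exists i0; last first.
    by apply: contraTneq uv0 => ->; rewrite mul0r ltxx.
  rewrite inE; apply/negP => /upP[k]; rewrite mxE.
  case: ifP => [|uvk uk ki0]; first by rewrite eqxx.
  have u0 : u 0 i0 != 0 by apply: contraTneq uv0 => ->; rewrite mul0r ltxx.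
  have ki : k = i0 by apply: (supp_min Eu u0) => //; exact: supp_up.
  by rewrite ki uv0 in uvk.
Qed.

(** Let [a] collect the minimal elements of the union of the supports and [b] the rest, with common
    elements going to both. An ideal met by [a] is met by [u] or [v], and one met by [b] is met by
    both, so the total height cannot grow. *)
Lemma exchange_up u v : E u -> E v -> (forall i, 0 <= u 0 i * v 0 i) ->
  ~~ (up u \subset up v) -> ~~ (up v \subset up u) ->
  exists a b, [/\ E a, E b, a + b = u + v & height a + height b < height u + height v].
Proof.
move=> Eu Ev uv uNv vNu.
have [/enriched_pointsP[us uA] /enriched_pointsP[vs vA]] := (Eu, Ev).
have uv_eq i : u 0 i != 0 -> v 0 i != 0 -> u 0 i = v 0 i.
  have := uv i; rewrite -(us i) -(vs i) !sgr_eq0.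
  case: (sgrP (u 0 i)) => //; case: (sgrP (v 0 i)) => // _ _.
  - by rewrite mulrN1 ler0N1.
  - by rewrite mulr1 ler0N1.
pose S := supp u :|: supp v.
pose m i := [forall k in S, le k i ==> (k == i)].
have mP i k : m i -> k \in S -> le k i -> k = i.
  by move=> /forall_inP h kS ki; apply/eqP; have /implyP := h k kS; apply.
have mN i : ~~ m i -> exists k, [/\ k \in S, le k i & k != i].
  by move=> /forall_inPn[k kS]; rewrite negb_imply => /andP[ki kni]; exists k.
have anti x i j : antichain le (supp x) -> x 0 i != 0 -> x 0 j != 0 -> le i j -> i = j.
  move=> xA xi xj ij; apply/eqP/negPn/negP => nij.
  by have := xA i j; rewrite !inE xi xj nij ij => /(_ isT isT isT)[].
have m_both i : u 0 i != 0 -> v 0 i != 0 -> m i.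
  move=> ui vi; apply/forall_inP => k; rewrite !inE => /orP[uk|vk]; apply/implyP => ki.
    by apply/eqP; exact: (anti u).
  by apply/eqP; exact: (anti v).
have m_below u' v' i : antichain le (supp u') -> u' 0 i != 0 -> ~~ m i ->
    S = supp u' :|: supp v' -> exists k, [/\ v' 0 k != 0, le k i & k != i].
  move=> uA' ui' /mN[k []]; move=> + + + SE; rewrite SE !inE => /orP[uk|vk] ki kni.
    by move: kni; rewrite (anti u' k i) ?eqxx.
  by exists k.
pose a : 'rV[R]_n := \row_i (if m i then if u 0 i == 0 then v 0 i else u 0 i else 0).
pose b := u + v - a.
have bE i : b 0 i = if m i then if (u 0 i != 0) && (v 0 i != 0) then u 0 i else 0
                    else u 0 i + v 0 i.
  rewrite !mxE; case: ifP => [mi|_]; last by rewrite subr0.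
  have [ui|ui] := eqVneq (u 0 i) 0; first by rewrite ui /= add0r subrr.
  have [vi|vi] := eqVneq (v 0 i) 0; first by rewrite vi /= addr0 subrr.
  by rewrite /= -(uv_eq i ui vi) addrK.
have b_cases i : b 0 i != 0 -> (u 0 i != 0 /\ v 0 i != 0) \/
    (~~ m i /\ ((u 0 i != 0 /\ v 0 i = 0) \/ (u 0 i = 0 /\ v 0 i != 0))).
  rewrite bE; case: ifP => [_|/negbT mi].
    by case: ifP; rewrite ?eqxx// => /andP[? ?] _; left.
  have [ui|ui] := eqVneq (u 0 i) 0; have [vi|vi] := eqVneq (v 0 i) 0;
    rewrite ?ui ?vi ?addr0 ?eqxx// => _; [by right; split; auto|by right; split; auto|].
  by rewrite m_both in mi.
have b_hits i : b 0 i != 0 -> exists j k, [/\ u 0 j != 0, v 0 k != 0, le j i & le k i].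
  move=> /b_cases[[ui vi]|[mi [[ui _]|[_ vi]]]].
  - by exists i, i.
  - have [k [vk ki _]] := m_below u v i uA ui mi erefl.
    by exists i, k.
  - have [k [uk ki _]] := m_below v u i vA vi mi (finset.setUC _ _).
    by exists k, i.
have Ea : E a.
  apply/enriched_pointsP; split => [i|i j].
    by rewrite mxE; case: ifP => _; [case: ifP => _|]; rewrite ?sgr0 ?us ?vs.
  have am k : a 0 k != 0 -> m k /\ k \in S.
    rewrite mxE; case: ifP => [mk uvk|]; last by rewrite eqxx.
    split => //; rewrite !inE; move: uvk.
    by have [_ ->|] := eqVneq (u 0 k) 0; rewrite ?orbT.
  rewrite !inE => /am[mi iS] /am[mj jS] ij.
  by split; apply: contra ij => ij; rewrite ?(mP _ _ mj iS ij)// (mP _ _ mi jS ij).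
have Eb : E b.
  apply/enriched_pointsP; split => [i|].
    have [->|/b_cases] := eqVneq (b 0 i) 0; first exact: sgr0.
    move=> [[ui vi]|[mi [[ui vi]|[ui vi]]]]; rewrite bE.
    + by rewrite m_both// ui vi us.
    + by rewrite (negPf mi) vi addr0 us.
    + by rewrite (negPf mi) ui add0r vs.
  have no_le i j : b 0 i != 0 -> b 0 j != 0 -> le i j -> i = j.
    move=> bi bj ij; apply/eqP/negPn/negP => nij.
    have [j1 [k1 [uj1 vk1 j1i k1i]]] := b_hits i bi.
    move: (b_cases j bj) => [[uj vj]|[mj [[uj vj]|[uj vj]]]].
    + have ji1 := anti _ _ _ uA uj1 uj (le_tr j1i ij).
      by move: nij; rewrite -ji1 (le_antisym j1i) ?eqxx// ji1.
    + have ji1 := anti _ _ _ uA uj1 uj (le_tr j1i ij).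
      by move: nij; rewrite -ji1 (le_antisym j1i) ?eqxx// ji1.
    + have ji1 := anti _ _ _ vA vk1 vj (le_tr k1i ij).
      by move: nij; rewrite -ji1 (le_antisym k1i) ?eqxx// ji1.
  move=> i j; rewrite !inE => bi bj ij.
  by split; apply: contra ij => /no_le ->.
have hits_a Z : hits a Z -> hits u Z || hits v Z.
  move=> /hitsP[i iZ]; rewrite mxE; case: ifP; last by rewrite eqxx.
  move=> _; case: ifP => [_ vi|/negbT ui _]; apply/orP; [right|left];
    by apply/hitsP; exists i.
have hits_b Z : downset Z -> hits b Z -> hits u Z && hits v Z.
  move=> /downsetP dZ /hitsP[i iZ /b_hits[j [k [uj vk ji ki]]]].
  by apply/andP; split; apply/hitsP; [exists j|exists k] => //; exact: dZ iZ _.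
exists a, b; split => //; first by rewrite addrC subrK.
(* The drop is strict at the complement of the common filter: neither filter contains the other, so
   [u] and [v] both meet it, while the filter of [b] lies in the intersection. *)
rewrite /height -!big_split/=; apply: (@ltr_sum_downset _ _ (~: (up u :&: up v))).
- apply: downsetC; apply/upsetP => i j; rewrite !finset.in_setI => /andP[iu iv] ij.
  by rewrite !(upsetP _ (upset_up _) i j).
- move=> Z dZ; rewrite -!natrD ler_nat.
  have := hits_b Z dZ; case: (hits b Z) => [/(_ isT)/andP[-> ->]|_].
    by rewrite leq_add2r leq_b1.
  by have := hits_a Z; case: (hits a Z) => // /(_ isT); case: (hits u Z); case: (hits v Z).
- have dZ : downset (~: (up u :&: up v)).
    apply: downsetC; apply/upsetP => i j; rewrite !finset.in_setI => /andP[iu iv] ij.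
    by rewrite !(upsetP _ (upset_up _) i j).
  rewrite !hits_up// finset.setCK -!natrD ltr_nat.
  rewrite !finset.subsetI !fintype.subxx /= andbT uNv vNu.
  suff : up b \subset up u :&: up v.
    by rewrite finset.subsetI => ->; rewrite addn0 ltnS leq_b1.
  apply/fintype.subsetP => i /upP[j /b_hits[j1 [k1 [uj vk ji ki]]] jli].
  rewrite inE; apply/andP; split; apply/upP; [exists j1|exists k1] => //;
  exact: le_tr jli.
Qed.

Lemma exchange u v : E u -> E v -> ~ compat u v ->
  exists a b, [/\ E a, E b, a + b = u + v & height a + height b < height u + height v].
Proof.
move=> Eu Ev uv; have [/forallP uvs|] := boolP [forall i, 0 <= u 0 i * v 0 i].
  have [uvF|] := boolP ((up u \subset up v) || (up v \subset up u)); first by case: uv.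
  by rewrite negb_or => /andP[? ?]; exact: exchange_up.
by rewrite negb_forall => /existsP[i]; rewrite -ltNge; exact: exchange_orthant.
Qed.

(** * Supporting functionals from signed chains *)

Lemma face_sign s : face s -> exists e : 'I_n -> R,
  (forall i, e i = 1 \/ e i = -1) /\
  (forall v, v \in s -> forall i, v 0 i != 0 -> v 0 i = e i).
Proof.
move=> [sE sc].
(* The sign 1 is the default where every vertex vanishes. *)
exists (fun i => if `[< exists2 v, v \in s & v 0 i = -1 >] then -1 else 1).
split => [i|v vs i vi]; first by case: ifP; [right|left].
have /enriched_pointsP[vsg _] := sE v vs.
case: asboolP => [[u us ui]|nex].
  have [uv _] := sc u v us vs; have := uv i.
  by move: vi; rewrite ui -(vsg i); case: sgrP => // _; rewrite ?eqxx// mulr1 ler0N1.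
move: vi; rewrite -(vsg i); case: (sgrP (v 0 i)) => //; first by rewrite eqxx.
by move=> vi _; case: nex; exists v => //; rewrite -(vsg i); apply/ltr0_sg.
Qed.

(** Among the vertices meeting [Z] take one with the smallest filter and an element [a] of its
    support in [Z]. The filters of the other vertices meeting [Z] contain [a], so these vertices
    meet the principal ideal of [a]; recursion there gives a chain below [a], to which [a] is
    added. *)
Lemma hitting_chain s Z : face s -> downset Z -> exists C : {set 'I_n},
  [/\ antichain (incomparability le) C, C \subset Z &
    forall v, v \in s -> hits v Z -> exists2 i, i \in C & v 0 i != 0].
Proof.
have [k] := ubnP #|` s|; elim: k s Z => // k IH s Z sk fs dZ.
pose P := [pred v : s | hits (val v) Z].
case: (pickP P) => [v0 Pv0|none]; last first.
  exists finset.set0; split; rewrite ?finset.sub0set//.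
    by move=> i; rewrite finset.in_set0.
  by move=> v vs vZ; have := none [` vs]%fset; rewrite /= vZ.
case: (arg_minnP (fun v : s => #|up (val v)|) Pv0) => v vZ vmin.
have /hitsP[a aZ va] := vZ.
have [|||C [Cchain /fintype.subsetP Ca Chits]] :=
    IH (s `\ val v)%fset [set j | le j a]%SET.
- by rewrite -ltnS (leq_trans _ sk)// [X in (_ < X.+1)%N](cardfsD1 (val v)) fsvalP.
- by apply: face_sub fs _; exact: fsubD1set.
- by apply/downsetP => i j; rewrite !inE => ja ij; exact: le_tr ja.
exists (a |: C); split.
- apply/(chainP _ le_refl) => i j; rewrite !finset.in_setU1.
  move=> /predU1P[->|iC] /predU1P[->|jC]; rewrite ?le_refl//.
  + by have := Ca j jC; rewrite inE => ->; rewrite orbT.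
  + by have := Ca i iC; rewrite inE => ->.
  + exact: (iffLR (chainP C le_refl)).
- rewrite finset.subUset finset.sub1set aZ; apply/fintype.subsetP => i /Ca.
  by rewrite inE => ia; apply: (downsetP _ dZ) ia.
- move=> u us uZ; have [->|uv] := eqVneq u (val v); first by exists a; rewrite ?setU11.
  have [||i iC ui] := Chits u; first by rewrite in_fsetD1 uv.
    have : a \in up u.
      have := vmin [` us]%fset uZ; rewrite /= => cvu.
      have [_ /orP[uvs|/fintype.subsetP]] := fs.2 u (val v) us (fsvalP v).
        have -> : up u = up (val v) by apply/eqP; rewrite eqEcard uvs.
        exact: supp_up.
      by apply; exact: supp_up.
    by move=> /upP[j uj ja]; apply/hitsP; exists j; rewrite ?inE.
  by exists i => //; rewrite finset.in_setU1 iC orbT.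
Qed.

(** On every signed antichain such a [z] is at most the indicator of meeting [Z], with equality on
    [s]. Summing one for each order ideal supports the heights along [s]. *)
Definition hitting s Z z : Prop := [/\ E' z, forall i, z 0 i != 0 -> i \in Z &
  forall v, v \in s -> dotp z v = (hits v Z)%:R].

Lemma ex_hitting s Z : face s -> downset Z -> exists z, hitting s Z z.
Proof.
move=> fs dZ; have [C [Cchain /fintype.subsetP CZ Chits]] := hitting_chain fs dZ.
have [e [e1 se]] := face_sign fs.
have esg i : Num.sg (e i) = e i by case: (e1 i) => ->; rewrite ?sgrN sgr1.
(* The signs are those of an orthant containing the face, so the common element of chain and vertex
   contributes 1. *)
pose z : 'rV[R]_n := \row_i (if i \in C then e i else 0).
have zC i : z 0 i != 0 -> i \in C by rewrite mxE; case: ifP; rewrite ?eqxx.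
have zE' : E' z.
  apply/enriched_pointsP; split => [i|].
    by rewrite mxE; case: ifP; rewrite ?sgr0.
  by apply: antichain_sub Cchain; apply/fintype.subsetP => i; rewrite inE => /zC.
exists z; split => // [i /zC /CZ//|v vs].
case: (boolP (hits v Z)) => [vZ|vZ].
  have [i iC vi] := Chits v vs vZ.
  have zi : z 0 i = v 0 i by rewrite mxE iC (se v vs).
  rewrite (dotp_chain_antichain (fs.1 v vs) zE' vi) zi//.
  exact: enriched_points_eq1 (fs.1 v vs) vi.
apply: dotp_disjoint => i /zC /CZ iZ; apply/eqP; apply: contraNT vZ => vi.
by apply/hitsP; exists i.
Qed.

Lemma dotp_le_hits z v Z : E' z -> (forall i, z 0 i != 0 -> i \in Z) -> E v ->
  dotp z v <= (hits v Z)%:R.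
Proof.
move=> zE' zZ vE; have [/existsP[i /andP[zi vi]]|] :=
    boolP [exists i, (z 0 i != 0) && (v 0 i != 0)].
  rewrite (dotp_chain_antichain vE zE' vi zi).
  have -> : hits v Z by apply/hitsP; exists i => //; exact: zZ.
  have [[zs _] [vs _]] := (iffLR (enriched_pointsP _ _) zE', iffLR (enriched_pointsP _ _) vE).
  exact: sgr_fix_mul_le1.
rewrite negb_exists => /forallP nzv; rewrite dotp_disjoint// => i zi.
by apply/eqP; have := nzv i; rewrite zi /= negbK.
Qed.

(** The summand at one ideal [Z0] is left to choice: strictness there makes the whole sum strict. *)
Lemma hitting_support s Z0 z0 : face s -> downset Z0 -> hitting s Z0 z0 ->
  exists c, [/\ forall a, E a -> dotp c a <= height a,
    forall v, v \in s -> dotp c v = height v &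
    forall a, E a -> dotp z0 a < (hits a Z0)%:R -> dotp c a < height a].
Proof.
move=> fs dZ0 hz0.
have /choice[z zP] : forall Z, exists z, downset Z -> hitting s Z z.
  move=> Z; case: (boolP (downset Z)) => [dZ|_]; last by exists 0.
  by have [z hz] := ex_hitting fs dZ; exists z.
pose y Z := if Z == Z0 then z0 else z Z.
have yP Z : downset Z -> hitting s Z (y Z).
  by rewrite /y; case: eqP => [->//|_]; exact: zP.
exists (\sum_(Z | downset Z) y Z).
have sumE a : dotp (\sum_(Z | downset Z) y Z) a = \sum_(Z | downset Z) dotp (y Z) a.
  by rewrite dotpC dotp_sumr; apply: eq_bigr => Z _; rewrite dotpC.
have yle Z a : downset Z -> E a -> dotp (y Z) a <= (hits a Z)%:R.
  by move=> /yP[yE' yZ _]; exact: dotp_le_hits.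
split.
- by move=> a aE; rewrite sumE; apply: ler_sum => Z dZ; exact: yle.
- by move=> v vs; rewrite sumE; apply: eq_bigr => Z /yP[_ _ ->].
- move=> a aE lta; rewrite sumE; apply: ltr_sum_downset dZ0 _ _.
    by move=> Z dZ; exact: yle.
  by rewrite /y eqxx.
Qed.

(** The vertices of [s] do not distinguish [Z] from the complement of the filter of [a], but [a]
    does. For [Z] serves the complement of the largest filter of [s] inside that of [a], or the
    whole ground set if there is none. *)
Lemma separating_downset s a : face s -> E a -> a \notin s -> a != 0 ->
  (forall v, v \in s -> compat a v) -> exists Z, [/\ downset Z,
    ~: up a \subset Z, hits a Z &
    forall v, v \in s -> hits v Z = hits v (~: up a)].
Proof.
move=> fs Ea anots a0 ac.
have da : downset (~: up a) by apply: downsetC; exact: upset_up.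
(* Vertices whose filter is not inside that of [a] already meet the complement of the latter; only
   the others must be made to miss [Z]. *)
suff [Z [dZ aZ ha hZ]] : exists Z, [/\ downset Z, ~: up a \subset Z, hits a Z &
    forall v, v \in s -> up v \subset up a -> ~~ hits v Z].
  exists Z; split => // v vs; apply/idP/idP => [vZ|/hitsP[i ia vi]].
    by rewrite hits_up// finset.setCK; apply: contraL vZ; exact: hZ.
  by apply/hitsP; exists i => //; exact: (fintype.subsetP aZ).
pose P := [pred v : s | up (val v) \subset up a].
case: (pickP P) => [v0 Pv0|none]; last first.
  exists [set: 'I_n]%SET; split; rewrite ?finset.subsetT//.
  - by apply/downsetP => i j _ _; rewrite inE.
  - apply/hitsP; suff [i ai] : exists i, a 0 i != 0 by exists i.
    apply/existsP; apply: contra_neqT a0; rewrite negb_exists => /forallP h.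
    by apply/rowP => i; rewrite mxE; apply/eqP/negPn/h.
  - by move=> v vs va; have := none [` vs]%fset; rewrite /= va.
case: (arg_maxnP (fun v : s => #|up (val v)|) Pv0) => v va vmax.
exists (~: up (val v)); split.
- by apply: downsetC; exact: upset_up.
- by rewrite finset.setCS.
- rewrite hits_up ?finset.setCK; last by apply: downsetC; exact: upset_up.
  apply: contra anots => av; rewrite (compat_up_eq Ea (fs.1 _ (fsvalP v)) (ac _ (fsvalP v))).
    exact: fsvalP.
  by apply/eqP; rewrite finset.eqEsubset av.
- move=> u us ua; rewrite hits_up ?finset.setCK ?negbK; last first.
    by apply: downsetC; exact: upset_up.
  have := vmax [` us]%fset ua; rewrite /= => cvu.
  have [_ /orP[//|uv]] := fs.2 u (val v) us (fsvalP v).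
  suff -> : up u = up (val v) by [].
  by apply/esym/eqP; rewrite eqEcard uv.
Qed.

(** All signed antichains, the origin included: the vertices of the triangulation rather than of the
    polytope. *)
Definition vertices : {fset 'rV[R]_n} := fset_set E.

Lemma verticesP v : v \in vertices <-> E v.
Proof. by rewrite /vertices in_fset_set ?inE//; exact: finite_enriched_points. Qed.

Lemma height0 : height 0 = 0.
Proof. by rewrite /height big1// => Z _; rewrite hits0. Qed.

Lemma exposed_face s : face s -> exposed vertices height s.
Proof.
move=> fs.
have dT : downset [set: 'I_n]%SET by apply/downsetP => i j _ _; rewrite inE.
have [zT hT] := ex_hitting fs dT.
have [c [cle ceq _]] := hitting_support fs dT hT.
apply: exposed_pointwise.
  exists c, 0; split => [a /verticesP aE|v vs]; rewrite addr0; first exact: cle.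
  exact: ceq.
move=> a /verticesP aE anots.
have [ac|] := pselect (forall v, v \in s -> compat a v); last first.
  move=> /existsNP[v /not_implyP[vs nav]]; exists c, 0; split.
  - by move=> b /verticesP bE; rewrite addr0 cle.
  - by move=> u us; rewrite addr0 ceq.
  (* Touching at both [a] and [v] would make the functional exceed the total height of the exchanged
     pair, which has the same sum. *)
  have [x [y [xE yE xy hxy]]] := exchange aE (fs.1 v vs) nav.
  rewrite addr0 lt_neqAle cle// andbT; apply/eqP => ca.
  have := le_lt_trans (lerD (cle x xE) (cle y yE)) hxy.
  by rewrite -dotpDr xy dotpDr ca (ceq v vs) ltxx.
(* A linear functional always touches the height 0 at the origin, so a constant is required: add
   [zT], which is 1 on the nonzero vertices of [s], and subtract 1. *)
have [a0|a0] := eqVneq a 0.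
  have [zE' zT_ zhits] := hT; have hle b : (hits b [set: 'I_n]%SET)%:R <= 1 :> R.
    by rewrite lern1 leq_b1.
  have addE b : dotp (c + zT) b - 1 = dotp c b + (dotp zT b - 1).
    by rewrite dotpC dotpDr ![dotp b _]dotpC addrA.
  exists (c + zT), (-1); split.
  - move=> b /verticesP bE; rewrite addE.
    have := cle b bE; have := dotp_le_hits zE' zT_ bE; have := hle b; lra.
  - move=> v vs; rewrite addE (ceq v vs) (zhits v vs).
    suff -> : hits v [set: 'I_n]%SET by rewrite subrr addr0.
    rewrite hits_up// finset.setCT finset.subset0; apply: contra anots => /eqP v0.
    suff -> : a = v by [].
    rewrite a0.
    apply: compat_up_eq; [exact: enriched_points0|exact: fs.1|exact: compat0|].
    by rewrite up0 v0.
  - by rewrite a0 height0 !dotp0r add0r oppr_lt0 ltr01.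
(* The chain chosen for the complement of the filter of [a] also serves for [Z], yet its functional
   vanishes at [a], which meets [Z]. *)
have [Z [dZ aZ ha hZ]] := separating_downset fs aE anots a0 ac.
have da : downset (~: up a) by apply: downsetC; exact: upset_up.
have [z [zE' za zhits]] := ex_hitting fs da.
have hz : hitting s Z z.
  split => // [i /za|v vs]; last by rewrite zhits// hZ.
  exact: (fintype.subsetP aZ).
have [c' [cle' ceq' clt']] := hitting_support fs dZ hz.
exists c', 0; split; rewrite ?addr0.
- by move=> b /verticesP bE; rewrite addr0 cle'.
- by move=> v vs; rewrite addr0 ceq'.
- apply: clt' => //; rewrite ha; suff -> : dotp z a = 0 by rewrite ltr01.
  apply: dotp_disjoint => i /za; rewrite inE => ia; apply/eqP.
  by apply: contraNT ia; exact: supp_up.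
Qed.

(** An affine function touching the heights at two incompatible points would exceed the total height
    of the exchanged pair. *)
Lemma face_exposed s : (s `<=` vertices)%fset -> exposed vertices height s -> face s.
Proof.
move=> /fsubsetP sv [c [d cd]].
have sE v : v \in s -> E v by move=> /sv /verticesP.
split => // u v us vs; apply: contrapT => nuv.
have [a [b [/verticesP aE /verticesP bE ab hab]]] := exchange (sE u us) (sE v vs) nuv.
have [_ [_ /(_ us) cu]] := cd u (sv u us).
have [_ [_ /(_ vs) cv]] := cd v (sv v vs).
have := lerD (cd a aE).1 (cd b bE).1.
rewrite addrACA -dotpDr ab dotpDr addrACA cu cv => h.
by have := le_lt_trans h hab; rewrite ltxx.
Qed.

(** * Greedy decomposition into compatible antichains *)

Definition chain C := forall i j, i \in C -> j \in C -> le i j || le j i.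

Lemma chain_sub C C' : C \subset C' -> chain C' -> chain C.
Proof. by move=> /fintype.subsetP CC' ch i j /CC' iC /CC'; exact: ch. Qed.

(* Greedy step: subtract from [x] the signed antichain of the minimal elements
   of its support, as many times as the smallest entry there allows.  Every
   maximal chain sum drops by exactly this amount, and the support shrinks. *)
Lemma greedy_step x M : x != 0 ->
  (forall C, chain C -> \sum_(i in C) `|x 0 i| <= M) ->
  exists v k i0, [/\ E v, 0 <= k, up v = up x,
    forall i, v 0 i = 0 \/ v 0 i = Num.sg (x 0 i) &
    [/\ forall i, exists2 r : R, 0 <= r & (x - k *: v) 0 i = r * x 0 i,
      (x - k *: v) 0 i0 = 0,
      v 0 i0 != 0 &
      forall C, chain C -> \sum_(i in C) `|(x - k *: v) 0 i| <= M - k]].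
Proof.
move=> x0 xM.
pose A := [set i in supp x | [forall j in supp x, le j i ==> (j == i)]]%SET.
have AP i : i \in A -> x 0 i != 0 /\ forall j, x 0 j != 0 -> le j i -> j = i.
  rewrite !inE => /andP[xi /forall_inP h]; split => // j xj ji.
  by apply/eqP; have := h j; rewrite inE xj => /(_ isT)/implyP; apply.
have below i : x 0 i != 0 -> exists2 a, a \in A & le a i.
  move=> xi; have [|a [aS ai amin]] := @min_below (supp x) i; first by rewrite inE.
  exists a => //; rewrite inE aS; apply/forall_inP => j jS; apply/implyP => ja.
  by apply/eqP; exact: amin.
have [i1 xi1] : exists i, x 0 i != 0.
  apply/existsP; apply: contra_neqT x0; rewrite negb_exists => /forallP h.
  by apply/rowP => i; rewrite mxE; apply/eqP/negPn/h.
have [a1 a1A _] := below i1 xi1.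
pose v : 'rV[R]_n := \row_i (if i \in A then Num.sg (x 0 i) else 0).
have suppv : supp v = A.
  apply/setP => i; rewrite inE mxE; case: ifP => [/AP[xi _]|]; last by rewrite eqxx.
  by rewrite sgr_eq0.
pose i0 := [arg min_(i < a1 in A) `|x 0 i|]%O.
have [i0A kmin] : i0 \in A /\ forall i, i \in A -> `|x 0 i0| <= `|x 0 i|.
  by rewrite /i0; case: Order.TotalTheory.arg_minP.
pose k := `|x 0 i0|.
(* Each entry is multiplied by a nonnegative factor, so no sign is reversed. *)
pose r i := if i \in A then 1 - k / `|x 0 i| else 1.
have r0 i : 0 <= r i.
  rewrite /r; case: ifP => // iA; rewrite subr_ge0 ler_pdivrMr ?mul1r ?kmin//.
  by rewrite normr_gt0; have [] := AP i iA.
have xE i : (x - k *: v) 0 i = r i * x 0 i.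
  rewrite !mxE /r; case: ifP => iA; last by rewrite mulr0 subr0 mul1r.
  have [xi _] := AP i iA; rewrite mulrBl mul1r; congr (_ - _).
  have nx : `|x 0 i| != 0 by rewrite normr_eq0.
  by apply: (mulIf nx); rewrite -mulrA -numEsg mulrAC divfK.
have absE i : `|(x - k *: v) 0 i| = `|x 0 i| - (if i \in A then k else 0).
  rewrite xE normrM ger0_norm// /r; case: ifP => iA; last by rewrite mul1r subr0.
  by have [xi _] := AP i iA; rewrite mulrBl mul1r divfK ?normr_eq0.
exists v, k, i0; split.
- apply/enriched_pointsP; rewrite suppv; split => [i|i j iA jA ij].
    by rewrite mxE; case: ifP; rewrite ?sgr0 ?sgr_id.
  have [[xi imin] [xj jmin]] := (AP i iA, AP j jA).
  by split; apply: contra ij => /[dup] ij; [rewrite (jmin i)|rewrite (imin j)].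
- exact: normr_ge0.
- apply/setP => i; apply/upP/upP => -[j].
    by move=> vj ji; exists j => //; have [] := AP j _; rewrite // -suppv inE.
  move=> /below[a aA aj] ji; exists a; last exact: le_tr ji.
  by move: aA; rewrite -suppv inE.
- by move=> i; rewrite mxE; case: ifP; [right|left].
- split; first by move=> i; exists (r i).
  + by rewrite xE /r i0A divff ?subrr ?mul0r// normr_eq0; have [] := AP i0 i0A.
  + by move: i0A; rewrite -suppv inE.
move=> C Cch.
have [[i2 i2C xi2]|none] := pselect (exists2 i, i \in C & x 0 i != 0); last first.
  rewrite big1 => [|i iC]; last first.
    rewrite xE; have [->|xi] := eqVneq (x 0 i) 0; first by rewrite mulr0 normr0.
    by case: none; exists i.
  (* On a chain missing the support the sum is zero, and [k <= M] comes from the one-element chain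
     at [i0]. *)
  rewrite subr_ge0; have := xM [set i0]%SET; rewrite big_set1; apply.
  by move=> i j; rewrite !inE => /eqP -> /eqP ->; rewrite le_refl.
(* Extend the part of [C] in the support by a minimal element [a] below its least element. The
   longer chain has old sum at most [M], and its sum drops by at least [k] because it meets [A]. *)
pose C1 := C :&: supp x.
have [|c [cC1 _ cmin]] := @min_below C1 i2; first by rewrite !inE i2C.
have cle j : j \in C1 -> le c j.
  move=> jC1; have [cC jC] : c \in C /\ j \in C.
    by move: cC1 jC1; rewrite !inE => /andP[? _] /andP[].
  by have /orP[//|jc] := Cch c j cC jC; rewrite (cmin j).
have [a aA ac] : exists2 a, a \in A & le a c.
  by apply: below; move: cC1; rewrite !inE => /andP[].
have C2ch : chain (a |: C1).
  move=> i j; rewrite !finset.in_setU1 => /predU1P[->|iC1] /predU1P[->|jC1].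
  - by rewrite le_refl.
  - by rewrite (le_tr ac) ?cle.
  - by rewrite orbC (le_tr ac) ?cle.
  - by apply: (chain_sub _ Cch) iC1 jC1; exact: finset.subsetIl.
have sub_abs : \sum_(i in C) `|(x - k *: v) 0 i| <=
    \sum_(i in a |: C1) `|(x - k *: v) 0 i|.
  rewrite [leLHS](bigID (mem (a |: C1)))/= [X in _ + X]big1 ?addr0.
    rewrite [leRHS](bigID (mem C))/= [X in X <= _](_ : _ =
        \sum_(i in a |: C1 | i \in C) `|(x - k *: v) 0 i|).
      by rewrite lerDl sumr_ge0.
    by apply: eq_bigl => i; rewrite andbC.
  move=> i /andP[iC]; rewrite finset.in_setU1 !inE iC negb_or negbK /= => /andP[_ /eqP xi].
  by rewrite xE xi mulr0 normr0.
apply: (le_trans sub_abs).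
under eq_bigr do rewrite absE.
rewrite sumrB lerB//; first exact: xM.
rewrite (bigD1 a) ?finset.setU11//= aA lerDl sumr_ge0// => i _.
by case: ifP => // _; exact: normr_ge0.
Qed.

(** The last clause carries the induction: later vertices have filters inside that of [x], which is
    the filter of the first vertex, and signs agreeing with [x], so they are compatible with the
    first. *)
Lemma greedy x M : (forall C, chain C -> \sum_(i in C) `|x 0 i| <= M) ->
  exists s l, [/\ face s, forall v, v \in s -> 0 <= l v, \sum_(v <- s) l v <= M,
    x = \sum_(v <- s) l v *: v &
    forall v, v \in s -> up v \subset up x /\
      forall i, v 0 i = 0 \/ v 0 i = Num.sg (x 0 i)].
Proof.
have [k] := ubnP #|supp x|; elim: k x M => // k IH x M xk xM.
have [->|x0] := eqVneq x 0.
  exists fset0, (fun=> 0); split; rewrite ?big_seq_fset0//.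
  have := xM finset.set0; rewrite big_set0; apply.
  by move=> i j; rewrite finset.in_set0.
have [v [c [i0 [vE c0 vup vs [xr x'0 vi0 x'M]]]]] := greedy_step x0 xM.
set x' := x - c *: v in xr x'0 x'M.
have x'sub : supp x' \subset supp x :\ i0.
  apply/fintype.subsetP => i; rewrite !inE => x'i.
  have -> /= : i != i0 by apply: contraNneq x'i => ->; rewrite x'0.
  by have [r _ x'E] := xr i; apply: contraNneq x'i => xi; rewrite x'E xi mulr0.
have xi0 : x 0 i0 != 0.
  by have [vz|vz] := vs i0; move: vi0; rewrite vz ?eqxx// sgr_eq0.
have [|s [l [fs l0 lM x'E sx']]] := IH x' (M - c) _ x'M.
  rewrite -ltnS (leq_trans _ xk)// ltnS (leq_ltn_trans (subset_leq_card x'sub))//.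
  by rewrite [X in (_ < X)%N](cardsD1 i0) inE xi0.
(* Otherwise [i0] would lie above another element of the support of [x], although it is minimal
   there. *)
have vs' : v \notin s.
  apply/negP => /sx'[vx' _].
  have /upP[j x'j ji0] := fintype.subsetP vx' i0 (supp_up vi0).
  have := fintype.subsetP x'sub j; rewrite !inE => /(_ x'j)/andP[ji xj].
  move: ji; rewrite (supp_min vE vi0 _ ji0) ?eqxx// vup; exact: supp_up.
have sgx w : w \in s -> up w \subset up x /\
    forall i, w 0 i = 0 \/ w 0 i = Num.sg (x 0 i).
  move=> /sx'[wx' ws]; split.
    apply: (fintype.subset_trans wx'); apply: up_sub.
    exact: (fintype.subset_trans x'sub (subsetDl _ _)).
  move=> i; have [->|->] := ws i; first by left.
  have [r r0 ->] := xr i; rewrite sgrM.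
  by case: (sgrP r) r0 => // _ _; rewrite ?mul0r ?mul1r; [left|right].
pose l' w := if w == v then c else l w.
have l'l w : w \in s -> l' w = l w.
  by move=> ws; rewrite /l'; case: eqP => // wv; rewrite wv (negPf vs') in ws.
have l'v : l' v = c by rewrite /l' eqxx.
exists (v |` s)%fset, l'; split.
- apply: face_cons => // w ws; have [wx wsg] := sgx w ws; split => [i|].
    have [->|->] := vs i; first by rewrite mul0r.
    have [->|->] := wsg i; first by rewrite mulr0.
    by rewrite -expr2 sqr_ge0.
  by rewrite vup wx orbT.
- move=> w; rewrite in_fset1U => /predU1P[->|ws]; first by rewrite l'v.
  by rewrite l'l// l0.
- rewrite big_fsetU1//= l'v (eq_big_seq l) => [|w ws]; last exact: l'l.
  by rewrite addrC -lerBrDr.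
- rewrite big_fsetU1//= l'v (eq_big_seq (fun w => l w *: w)) => [|w ws].
    by rewrite -x'E addrC subrK.
  by rewrite l'l.
- move=> w; rewrite in_fset1U => /predU1P[->|]; last exact: sgx.
  by split; rewrite ?vup.
Qed.

(** * Inequalities and lattice points of the polytope *)

Local Notation EP := (enriched_chain_polytope R le).

Lemma chain_sum_le1 C v : chain C -> E v -> \sum_(i in C) `|v 0 i| <= 1.
Proof.
move=> Cch vE; have [vs vA] := iffLR (enriched_pointsP _ _) vE.
have [[i iC vi]|none] := pselect (exists2 i, i \in C & v 0 i != 0); last first.
  rewrite big1 ?ler01// => i iC.
  by have [->|vi] := eqVneq (v 0 i) 0; [rewrite normr0|case: none; exists i].
rewrite (bigD1 i)//= big1 ?addr0 => [|j /andP[jC ji]].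
  by rewrite -vs normr_sg lern1 leq_b1.
apply/normr0P; apply/negPn/negP => vj.
have := vA i j; rewrite !inE vi vj eq_sym ji => /(_ isT isT isT)[nij nji].
by have := Cch i j iC jC; rewrite (negPf nij) (negPf nji).
Qed.

Lemma convex_chain_sum C :
  @convex_set R 'rV[R]_n [set x | \sum_(i in C) `|x 0 i| <= 1].
Proof.
apply/convex_setP => x y t /= hx hy /andP[t0 t1].
apply: (@le_trans _ _ (\sum_(i in C) (t * `|x 0 i| + (1 - t) * `|y 0 i|))).
  apply: ler_sum => i _; rewrite !mxE (le_trans (ler_normD _ _))// !normrM.
  by rewrite (ger0_norm t0) (@ger0_norm _ (1 - t))// subr_ge0.
rewrite big_split/= -!mulr_sumr.
have t1' : 0 <= 1 - t by rewrite subr_ge0.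
by have := ler_wpM2l t0 hx; have := ler_wpM2l t1' hy; lra.
Qed.

(** The weight left over by the greedy decomposition goes to the origin, which is compatible with
    every point. *)
Lemma cover_face x : (forall C, chain C -> \sum_(i in C) `|x 0 i| <= 1) ->
  exists2 s, face s & convex_hull [set` s] x.
Proof.
move=> /greedy[s [l [fs l0 l1 xE _]]]; exists (0 |` s)%fset.
  by apply: face_cons => // [|u _]; [exact: enriched_points0|exact: compat0].
have sub1 : 0 <= 1 - \sum_(v <- s) l v by rewrite subr_ge0.
pose L o := if o is Some v then l v else 1 - \sum_(v <- s) l v.
pose f o : 'rV[R]_n := if o is Some v then v else 0.
have -> : x = \sum_(o <- None :: map Some s) L o *: f o.
  by rewrite big_cons big_map scaler0 add0r.
apply: convex_set_sum => [|o||o].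
- exact: convex_convex_hull.
- by rewrite in_cons => /predU1P[->//|/mapP[v vs ->]]; exact: l0.
- by rewrite big_cons big_map subrK.
- move=> oin _; apply: subset_convex_hull => /=; rewrite in_fset1U.
  by move: oin; rewrite in_cons => /predU1P[->|/mapP[v vs ->]]; rewrite /= ?eqxx ?vs ?orbT.
Qed.

Lemma enriched_chain_polytopeP x :
  EP x <-> forall C, chain C -> \sum_(i in C) `|x 0 i| <= 1.
Proof.
split => [EPx C Cch|/cover_face[s fs]].
  move: x EPx; apply: convex_hull_sub; first exact: convex_chain_sum.
  by move=> v; exact: chain_sum_le1.
by apply: le_convex_hull => v /= /fs.1.
Qed.

Lemma chain1 i : chain [set i]%SET.
Proof. by move=> j k; rewrite !inE => /eqP -> /eqP ->; rewrite le_refl. Qed.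

(** One-element chains force integer entries to be 0, 1 or -1, and two-element chains exclude
    comparable elements from the support. *)
Lemma lattice_enriched_chain_polytope : EP `&` @lattice_point R n = [set` vertices].
Proof.
apply/seteqP; split => [x [/enriched_chain_polytopeP xC /mxOverP xZ]|x /= /verticesP xE].
  apply/verticesP/enriched_pointsP.
  have xs i : Num.sg (x 0 i) = x 0 i.
    have := xC _ (@chain1 i); rewrite big_set1.
    have /intrP[m ->] := xZ 0 i; rewrite -intr_norm -[1]/(1%:~R) ler_int.
    case: m => [[|[|m]]|[|m]] // _; [exact: sgr0|exact: sgr1|].
    by rewrite NegzE mulrNz sgrN sgr1.
  split => // i j; rewrite !inE => xi xj ij.
  have abs1 k : x 0 k != 0 -> `|x 0 k| = 1 by move=> xk; rewrite -xs normr_sg xk.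
  apply/andP; rewrite -negb_or; apply/negP => ijc.
  have /xC : chain [set i; j]%SET.
    move=> a b; rewrite !inE => /orP[] /eqP -> /orP[] /eqP ->; rewrite ?le_refl//.
    by rewrite orbC.
  by rewrite big_setU1 ?inE//= big_set1 !abs1// gerDl ler10.
split; first exact: subset_convex_hull.
exact: enriched_points_lattice xE.
Qed.

(** * Maximal faces and their triangular matrices *)

Definition signed_min (e : 'I_n -> R) F : 'rV[R]_n :=
  \row_k (if (k \in F) && [forall j in F, le j k ==> (j == k)] then e k else 0).

Section SignedMin.
Variables (e : 'I_n -> R) (F : {set 'I_n}).
Hypotheses (e1 : forall i, e i = 1 \/ e i = -1) (Fup : upset F).

Lemma signed_minP k : reflect (k \in F /\ forall j, j \in F -> le j k -> j = k)
  (signed_min e F 0 k != 0).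
Proof.
have ek : e k != 0 by case: (e1 k) => ->; rewrite ?oppr_eq0 oner_eq0.
rewrite mxE; case: andP => [[kF /forall_inP kmin]|nk]; rewrite ?eqxx ?ek.
  apply: ReflectT; split => // j jF jk.
  by apply/eqP; have /implyP := kmin j jF; apply.
apply: ReflectF => -[kF kmin]; apply: nk; split => //.
by apply/forall_inP => j jF; apply/implyP => jk; apply/eqP; exact: kmin.
Qed.

Lemma signed_min_val k : signed_min e F 0 k = 0 \/ signed_min e F 0 k = e k.
Proof. by rewrite mxE; case: ifP; [right|left]. Qed.

Lemma signed_min_enriched : E (signed_min e F).
Proof.
apply/enriched_pointsP; split => [k|i j].
  have [->|->] := signed_min_val k; first exact: sgr0.
  by case: (e1 k) => ->; rewrite ?sgrN sgr1.
rewrite !inE => /signed_minP[iF imin] /signed_minP[jF jmin] ij.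
by split; apply: contra ij => /[dup] ij; [rewrite (jmin i)|rewrite (imin j)].
Qed.

Lemma up_signed_min : up (signed_min e F) = F.
Proof.
apply/setP => i; apply/upP/idP => [[j /signed_minP[jF _] ji]|iF].
  exact: (upsetP _ Fup) ji.
by have [a [aF ai amin]] := min_below iF; exists a => //; apply/signed_minP.
Qed.

End SignedMin.

(** Within the orthant of [e], passing to signed minimal elements undoes passing to the filter. *)
Lemma face_signed_min (e : 'I_n -> R) v : E v ->
  (forall i, e i = 1 \/ e i = -1) -> (forall i, v 0 i != 0 -> v 0 i = e i) ->
  v = signed_min e (up v).
Proof.
move=> vE e1 ve; apply/rowP => k.
have [vk|vk] := eqVneq (v 0 k) 0.
  rewrite vk; apply/esym/eqP/negPn/negP => /(signed_minP _ e1)[/upP[j vj jk] kmin].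
  by have jk' := kmin j (supp_up vj) jk; rewrite jk' vk eqxx in vj.
have : signed_min e (up v) 0 k != 0.
  apply/(signed_minP _ e1); split; first exact: supp_up.
  by move=> j jv jk; exact: supp_min vE vk jv jk.
by have [->|->] := signed_min_val e (up v) k; rewrite ?eqxx// => _; exact: ve.
Qed.

(* In a maximal simplex the filters form a maximal flag; [G i] is the smallest
   of them containing [i]. *)
Lemma maximal_face s : face s ->
  (forall t, face t -> (s `<=` t)%fset -> t = s) ->
  exists (V : 'M[R]_n) (r : 'I_n -> nat), unitriangular V r /\
    forall v, v \in s <-> v = 0 \/ exists i, v = row i V.
Proof.
move=> fs smax.
have add_in v : E v -> (forall u, u \in s -> compat v u) -> v \in s.
  move=> vE vs; rewrite -(smax (v |` s)%fset) ?fset1U1//; first exact: face_cons.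
  exact: fsubsetU1.
have [e [e1 se]] := face_sign fs.
(* Joining the principal filter of [i] with the filters of [s] that miss [i] gives a filter
   comparable with all filters of [s]; by maximality its signed minimal elements form a vertex of
   [s]. *)
pose G i := [set k | le i k || [exists v : s, (i \notin up (val v)) && (k \in up (val v))]]%SET.
have GP i k : reflect (le i k \/ exists v, [/\ v \in s, i \notin up v & k \in up v])
    (k \in G i).
  rewrite inE; apply: (iffP orP) => -[ik|]; [by left| |by left|].
    by move=> /existsP[v /andP[iv kv]]; right; exists (val v); split => //; exact: fsvalP.
  by move=> [v [vs iv kv]]; right; apply/existsP; exists [` vs]%fset; rewrite iv.
have Gup i : upset (G i).
  apply/upsetP => j k /GP[ij|[v [vs iv jv]]] jk; apply/GP.
    by left; exact: le_tr jk.
  by right; exists v; split => //; exact: (upsetP _ (upset_up v)) jk.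
have Gsub v i : v \in s -> i \in up v -> G i \subset up v.
  move=> vs iv; apply/fintype.subsetP => k /GP[ik|[w [ws iw kw]]].
    exact: (upsetP _ (upset_up v)) ik.
  have [_ /orP[/fintype.subsetP vw|/fintype.subsetP wv]] := fs.2 v w vs ws.
    by rewrite vw in iw.
  exact: wv.
have Gsup v i : v \in s -> i \notin up v -> up v \subset G i.
  by move=> vs iv; apply/fintype.subsetP => k kv; apply/GP; right; exists v.
pose V : 'M[R]_n := \matrix_(i, k) signed_min e (G i) 0 k.
have rowV i : row i V = signed_min e (G i) by apply/rowP => k; rewrite !mxE.
have ee k : 0 <= e k * e k by rewrite -expr2 sqr_ge0.
have Vs i : signed_min e (G i) \in s.
  apply: add_in => [|v vs]; first exact: signed_min_enriched.
  split => [k|].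
    have [->|vk] := eqVneq (v 0 k) 0; first by rewrite mulr0.
    have [->|->] := signed_min_val e (G i) k; first by rewrite mul0r.
    by rewrite (se v vs k vk).
  rewrite up_signed_min//; have [iv|iv] := boolP (i \in up v).
    by rewrite Gsub.
  by rewrite Gsup ?orbT.
have Gi i : i \in G i by apply/GP; left.
have GG i j : i \in G j -> G i \subset G j.
  by move=> iG; rewrite -(up_signed_min e1 (Gup j)) Gsub// up_signed_min.
(* If each element lies in the filter of the other, no filter of [s] separates them, so they are
   comparable both ways. Hence the filters [G i] are distinct and their sizes serve as ranks. *)
have Ganti i j : i \in G j -> j \in G i -> i = j.
  have le_of k l : k \in G l -> l \in G k -> le l k.
    move=> /[swap] lk /GP[//|[v [vs lv kv]]].
    by have /fintype.subsetP/(_ l lk) := Gsub v k vs kv; rewrite (negPf lv).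
  by move=> ij ji; apply: le_antisym; exact: le_of.
have Vnz i j : V j i != 0 -> i \in G j.
  by rewrite mxE => /(signed_minP _ e1)[].
exists V, (fun i => #|G i|); split; first split.
- move=> i; suff -> : V i i = e i by exact: e1.
  have : signed_min e (G i) 0 i != 0.
    apply/(signed_minP _ e1); split => // j /GP[ij ji|[v [vs iv jv]] ji].
      exact: le_antisym.
    by rewrite (upsetP _ (upset_up v) _ _ jv ji) in iv.
  by rewrite [V i i]mxE; have [->|] := signed_min_val e (G i) i; rewrite ?eqxx.
- move=> i j ij /Vnz iGj; apply: proper_card; rewrite finset.properEneq GG// andbT.
  by apply: contra ij => /eqP Gij; apply/eqP/Ganti => //; rewrite Gij.
move=> v; split => [vs|[->|[i ->]]]; last by rewrite rowV.
- have vE := face_signed_min (fs.1 v vs) e1 (se v vs).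
  have [v0|/finset.set0Pn[i0 i0v]] := eqVneq (up v) finset.set0.
    by left; apply/rowP => k; rewrite mxE; apply/eqP/negPn/negP => /supp_up; rewrite v0 inE.
  (* For [i] in the filter of [v] with [G i] largest, that filter is [G i]: an element [k] of it
     outside [G i] would have [G k] containing [G i] and no larger, hence equal to it. *)
  case: (arg_maxnP (fun i => #|G i|) i0v) => i iv imax.
  right; exists i; rewrite rowV vE; congr signed_min; apply/eqP.
  rewrite finset.eqEsubset (Gsub v)// andbT; apply/fintype.subsetP => k kv.
  have Gk := Gsub _ _ (Vs i); rewrite up_signed_min// in Gk.
  have [//|kGi] := boolP (k \in G i).
  have GiGk : G i \subset G k.
    by have := Gsup _ _ (Vs i); rewrite up_signed_min//; exact.
  have GiGk_eq : G i = G k by apply/eqP; rewrite eqEcard GiGk; exact: imax.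
  by rewrite GiGk_eq Gi in kGi.
- by apply: add_in => [|u _]; [exact: enriched_points0|exact: compat0].
Qed.

(** * The triangulation and its properties *)

Definition complex : {fset {fset 'rV[R]_n}} :=
  [fset s in fpowerset vertices | `[< face s >]]%fset.

Lemma complexP s : s \in complex <-> face s.
Proof.
rewrite !inE; split => [/andP[_ /asboolP//]|fs]; rewrite fpowersetE.
apply/andP; split; last exact/asboolP.
by apply/fsubsetP => v /fs.1 /verticesP.
Qed.

Lemma face_vertices s : face s -> (s `<=` vertices)%fset.
Proof. by move=> fs; apply/fsubsetP => v /fs.1 /verticesP. Qed.

Lemma triangulation_complex : triangulation EP complex.
Proof.
split.
- move=> s /complexP fs; split; last first.
    by move=> v /= /fs.1; exact: enriched_points_lattice.
  apply: (exposed_affinely_independent (face_vertices fs)) => t ts.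
  by apply: exposed_face; exact: face_sub ts.
- by move=> s t /complexP fs ts; apply/complexP; exact: face_sub ts.
- move=> s t /complexP fs /complexP ft.
  exact: (exposed_convex_hullI (face_vertices fs) (face_vertices ft)
    (exposed_face fs) (exposed_face ft)).
- apply/seteqP; split => [x [s /= /complexP fs]|x /enriched_chain_polytopeP/cover_face[s fs sx]].
    by apply: le_convex_hull => v /fs.1.
  by exists s => //=; apply/complexP.
Qed.

(** A non-face made of signed antichains contains an incompatible pair, which is itself a
    non-face. *)
Lemma flag_complex_complex : flag_complex complex.
Proof.
move=> s [vK sK tK].
have sE v : v \in s -> E v.
  by move=> /vK /complexP[+ _]; apply; rewrite inE.
have [u [v [us vs nuv]]] : exists u v, [/\ u \in s, v \in s & ~ compat u v].
  apply: contrapT => nex; apply: (negP sK); apply/complexP; split => // u v us vs.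
  by apply: contrapT => nuv; apply: nex; exists u, v.
have uv : u != v by apply/eqP => uv; apply: nuv; rewrite uv; exact: compat_refl.
have sub : ([fset u; v] `<=` s)%fset.
  by apply/fsubsetP => w; rewrite in_fset2 => /orP[] /eqP ->.
have [prop|] := boolP ([fset u; v] `<` s)%fset.
  have /complexP[_ c] := tK _ prop.
  by case: nuv; apply: c; rewrite in_fset2 eqxx ?orbT.
rewrite fproperEneq sub andbT negbK => /eqP <-.
by rewrite cardfs2 uv.
Qed.

Lemma regular_complex : regular EP complex.
Proof.
apply: (exposed_regular (E := vertices) (w := height)).
- by apply/fset0Pn; exists 0; apply/verticesP/enriched_points0.
- exact: lattice_enriched_chain_polytope.
- move=> s /complexP fs _; split; [exact: face_vertices|exact: exposed_face].
- by move=> s sv /face_exposed fs; apply/complexP; exact: fs.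
Qed.

Lemma maximal_complex s : maximal_simplex complex s -> exists (V : 'M[R]_n) r,
  unitriangular V r /\ forall v, v \in s <-> v = 0 \/ exists i, v = row i V.
Proof.
move=> [/complexP fs smax]; apply: (maximal_face fs) => t /complexP tK.
exact: smax.
Qed.

Lemma unimodular_complex : unimodular complex.
Proof.
move=> s /maximal_complex[V [r [Vr sE]]].
rewrite /normalized_volume (convex_hull_corner sE) (volume_corner_simplex _ Vr ler01).
rewrite expr1n mul1r -EFinM divff// pnatr_eq0 -lt0n; exact: fact_gt0.
Qed.

(** * Reflexivity and the dual polytope *)

Lemma full_dimensional_enriched_chain_polytope : full_dimensional EP.
Proof.
pose B := [fset (delta_mx 0 i : 'rV[R]_n) | i : 'I_n]%fset.
have dinj : injective (fun i => delta_mx 0 i : 'rV[R]_n).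
  move=> i j /rowP/(_ i); rewrite !mxE !eqxx /=.
  by case: eqP => // _ /eqP; rewrite oner_eq0.
have d0 i : (delta_mx 0 i : 'rV[R]_n) != 0.
  by apply/eqP => /rowP/(_ i)/eqP; rewrite !mxE !eqxx oner_eq0.
have B0 : 0 \notin B.
  by apply/negP => /imfsetP[i _ /esym/eqP]; rewrite (negPf (d0 i)).
exists (0 |` B)%fset; split.
- move=> a a0 a1.
  have aB v : v \in B -> a v = 0.
    move=> vB; have /imfsetP[i _ vE] := vB.
    have := congr1 (fun x : 'rV[R]_n => x 0 i) a1.
    rewrite big_fsetU1//= scaler0 add0r summxE (big_fsetD1 v)//= big1_seq.
      by rewrite vE !mxE !eqxx addr0 mulr1.
    move=> u /=; rewrite in_fsetD1 => /andP[uv /imfsetP[j _ uE]].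
    rewrite uE !mxE eqxx /=; case: eqP => [ij|]; last by rewrite mulr0.
    by move: uv; rewrite uE vE ij eqxx.
  move=> v; rewrite in_fset1U => /predU1P[->|]; last exact: aB.
  by move: a0; rewrite big_fsetU1//= big1_seq ?addr0// => u /=; exact: aB.
- by rewrite cardfsU1 B0 card_imfset//= -cardE card_ord.
- move=> v /=; rewrite in_fset1U => vB; apply: subset_convex_hull.
  have [->|/imfsetP[i _ ->]] := predU1P vB; first exact: enriched_points0.
  exact: enriched_points_delta.
Qed.

Lemma interior_enriched_chain_polytope : EP^° `&` @lattice_point R n = [set 0].
Proof.
apply/seteqP; split => [x [xint xlat]|_ ->]; last first.
  split; last by apply: (@enriched_points_lattice _ _ le); exact: enriched_points0.
  (* A chain has at most [n] elements, so with this radius all chain sums stay below 1; [n.+1] keeps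
     the radius positive when [n] is 0. *)
  apply/nbhs_ballP; exists n.+1%:R^-1 => /=; first by rewrite invr_gt0 ltr0n.
  move=> y [_ /= yb]; apply/enriched_chain_polytopeP => C _.
  have yi i : `|y 0 i| <= n.+1%:R^-1.
    by apply: ltW; have := yb 0 i; rewrite /ball /= mxE sub0r normrN.
  apply: (@le_trans _ _ (\sum_(i in C) n.+1%:R^-1)); first exact: ler_sum.
  rewrite sumr_const -[_ *+ #|C|]mulr_natl ler_pdivrMr ?ltr0n// mul1r ler_nat.
  by rewrite (leq_trans (max_card _))// card_ord.
have xE : E x.
  have : (EP `&` @lattice_point R n) x by split => //; exact: interior_subset.
  by rewrite lattice_enriched_chain_polytope => /verticesP.
apply/rowP => i; rewrite mxE; apply/eqP/negPn/negP => xi.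
have /nbhs_ballP[d /= d0 xd] := xint.
have abs1 j : `|x 0 j| <= 1.
  by have [<- _] := iffLR (enriched_pointsP _ _) xE; rewrite normr_sg lern1 leq_b1.
(* The dilated point stays in the ball because the entries of [x] are at most 1 in absolute value,
   but it violates the inequality of the one-element chain at [i]. *)
have /xd : ball x d ((1 + d / 2) *: x).
  split => // j k; rewrite (ord1 j) /ball /= !mxE.
  rewrite -{1}[x 0 k]mul1r -mulrBl opprD addrA subrr sub0r normrM normrN.
  have d2 : 0 <= d / 2 by lra.
  by rewrite (ger0_norm d2); have := ler_wpM2l d2 (abs1 k); lra.
move=> /enriched_chain_polytopeP/(_ _ (@chain1 i)); rewrite big_set1 mxE normrM.
have [xs _] := iffLR (enriched_pointsP _ _) xE.
by rewrite -[x 0 i]xs normr_sg xi mulr1 ger0_norm; lra.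
Qed.

(** The sum of absolute values over a chain is the pairing with the chain signed like [x]. So the
    dual of the signed chains lies in the polytope, and the bipolar theorem applies. *)
Lemma dual_enriched_chain_polytope :
  dual_polytope EP = convex_hull E'.
Proof.
apply/seteqP; split => [y yP|].
  apply: bipolar; [exact: finite_enriched_points|exact: enriched_points0|].
  move=> x xE'; apply: yP.
  apply/enriched_chain_polytopeP => C /(chainP _ le_refl) Cch.
  pose z : 'rV[R]_n := \row_i (if i \in C then Num.sg (x 0 i) else 0).
  have zE' : E' z.
    apply/enriched_pointsP; split => [i|].
      by rewrite mxE; case: ifP; rewrite ?sgr0 ?sgr_id.
    apply: antichain_sub Cch; apply/fintype.subsetP => i; rewrite inE mxE.
    by case: ifP; rewrite ?eqxx.
  apply: le_trans (xE' z zE'); rewrite [leRHS]/dotp big_mkcond/=.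
  by apply: ler_sum => i _; rewrite mxE; case: ifP; rewrite ?mul0r// normrEsg.
apply: convex_hull_sub => [|z zE' x].
  apply/convex_setP => y z t yP zP t01 x xP; rewrite dotpDr !dotpZr.
  by have := yP x xP; have := zP x xP; move: t01 => /andP[]; nra.
move: x; apply: (convex_hull_sub (B := [set x | dotp x z <= 1])).
  by under eq_set do rewrite dotpC; exact: convex_halfspace.
move=> v vE /=; rewrite dotpC.
have := @dotp_le_hits z v [set: 'I_n]%SET zE' (fun i _ => finset.in_setT i) vE.
by move=> /le_trans; apply; rewrite lern1 leq_b1.
Qed.

Lemma reflexive_enriched_chain_polytope : reflexive_polytope EP.
Proof.
split.
- exists E; split => //; first exact: finite_enriched_points.
  exact: enriched_points_lattice.
- exact: full_dimensional_enriched_chain_polytope.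
- exact: interior_enriched_chain_polytope.
- exists E'; split; [exact: finite_enriched_points|exact: enriched_points_lattice|].
  exact: dual_enriched_chain_polytope.
Qed.

End Poset.

Theorem theorem0p1 (R : realType) (n : nat) (le : rel 'I_n)
    (le_refl : reflexive le) (le_anti : antisymmetric le)
    (le_trans : transitive le) :
  reflexive_polytope (enriched_chain_polytope R le) /\
  exists K : {fset {fset 'rV[R]_n}},
    [/\ triangulation (enriched_chain_polytope R le) K,
        flag_complex K,
        regular (enriched_chain_polytope R le) K,
        unimodular K
      & forall s : {fset 'rV[R]_n}, maximal_simplex K s -> 0 \in s].
Proof.
split; first exact: reflexive_enriched_chain_polytope.
exists (complex R le); split.
- exact: triangulation_complex.
- exact: flag_complex_complex.
- exact: regular_complex.
- exact: unimodular_complex.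
- move=> s smax.
  have [V [r [_ sE]]] := maximal_complex le_refl le_anti le_trans smax.
  by apply/sE; left.
Qed.
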